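(* Let $\mathcal F$ be a division ring with an involutive anti-automorphism $*$ and of characteristic different from $2$. Let $A\in\mathcal F^{m\times p}$, $B\in\mathcal F^{m\times q}$, $C\in\mathcal F^{s\times p}$, $D\in\mathcal F^{p\times t}$, $\Phi=\Phi^*\in\mathcal F^{m\times m}$, $\Omega\in\mathcal F^{s\times t}$. The system of matrix equations $$AXA^*+BYB^*=\Phi,\qquad CXD=\Omega$$ has a pair of Hermitian solutions $(X,Y)\in\mathcal F^{p\times p}\times\mathcal F^{q\times q}$ (that is, a solution with $X=X^*$, $Y=Y^*$) if and only if all of the following rank equalities hold: $$\mathrm{r}\begin{pmatrix}\Phi&A\\ B^*&0\end{pmatrix}=\mathrm{r}(A)+\mathrm{r}(B),\quad \mathrm{r}(A,B,\Phi)=\mathrm{r}(A,B),$$ $$\mathrm{r}(C,\Omega)=\mathrm{r}(C),\quad \mathrm{r}\begin{pmatrix}D\\ \Omega\end{pmatrix}=\mathrm{r}(D),\quad \mathrm{r}\begin{pmatrix}\Omega&0&C\\ 0&-\Omega^*&D^*\\ D&C^*&0\end{pmatrix}=2\,\mathrm{r}\begin{pmatrix}C\\ D^*\end{pmatrix},$$ $$\mathrm{r}\begin{pmatrix}0&0&A^*&D\\ A&B&-\Phi&0\\ C&0&0&\Omega\end{pmatrix}=\mathrm{r}\begin{pmatrix}A&B\\ C&0\end{pmatrix}+\mathrm{r}(A^*,D),$$ $$\mathrm{r}\begin{pmatrix}0&A^*&D\\ 0&B^*&0\\ A&-\Phi&0\\ C&0&\Omega\end{pmatrix}=\mathrm{r}\begin{pmatrix}A^*&D\\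 B^*&0\end{pmatrix}+\mathrm{r}\begin{pmatrix}A\\ C\end{pmatrix},$$ $$\mathrm{r}\begin{pmatrix}0&0&A^*&D&C^*\\ 0&0&B^*&0&0\\ A&A&-\Phi&0&0\\ C&0&0&\Omega&0\\ 0&D^*&0&0&\Omega^*\end{pmatrix}=\mathrm{r}\begin{pmatrix}A&B\\ C&0\\ D^*&0\end{pmatrix}+\mathrm{r}\begin{pmatrix}A&A\\ C&0\\ 0&D^*\end{pmatrix},$$ $$\mathrm{r}\begin{pmatrix}0&0&0&A^*&D&C^*\\ A&A&B&-\Phi&0&0\\ C&0&0&0&\Omega&0\\ 0&D^*&0&0&0&\Omega^*\end{pmatrix}=\mathrm{r}\begin{pmatrix}A\\ C\\ D^*\end{pmatrix}+\mathrm{r}\begin{pmatrix}A&A&B\\ C&0&0\\ 0&D^*&0\end{pmatrix},$$ $$\mathrm{r}\begin{pmatrix}0&0&0&0&0&0&B^*\\ 0&0&0&C^*&0&A^*&0\\ 0&0&0&0&D&A^*&A^*\\ 0&C&0&0&-\Omega&0&0\\ 0&0&D^*&\Omega^*&0&0&0\\ 0&A&A&0&0&0&\Phi\\ B&0&A&0&0&-\Phi&0\end{pmatrix}=2\,\mathrm{r}\begin{pmatrix}0&A&B\\ A&A&0\\ C&0&0\\ 0&D^*&0\end{pmatrix}.$$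
   Context: $\mathcal F^{m\times n}$ is the set of $m\times n$ matrices over $\mathcal F$. For a matrix $A$ over $\mathcal F$, $A^*$ is its conjugate transpose: the transpose with the involutive anti-automorphism $*$ of $\mathcal F$ applied to each entry. A square matrix $X$ is Hermitian if $X=X^*$. The rank $\mathrm{r}(\cdot)$ of a matrix over $\mathcal F$ is the dimension of its left row space, equal to the dimension of its right column space. Blocks $0$ denote zero blocks of the appropriate size. *)

(* Defs.v *)
From HB Require Import structures.
From mathcomp Require Import all_boot all_order all_algebra.
From mathcomp Require Import boolp classical_sets.

Set Implicit Arguments.
Unset Strict Implicit.
Unset Printing Implicit Defensive.

Import GRing.Theory.
Local Open Scope ring_scope.

Definition involutive_antiautomorphism (F : nzRingType) (star : F -> F) : Prop :=
  [/\ {morph star : x y / x + y},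
      {morph star : x y / x * y >-> y * x}
    & involutive star].

Definition conjtrmx (F : nzRingType) (star : F -> F) (m n : nat)
  (A : 'M[F]_(m, n)) : 'M[F]_(n, m) := map_mx star A^T.

Notation "A ^^ star" := (conjtrmx star A)
  (at level 30, star at level 30, format "A ^^ star")
  : ring_scope.

Definition is_hermitian (F : nzRingType) (star : F -> F) (n : nat)
  (X : 'M[F]_n) : Prop := X = X^^star.

(* Block matrices: A <|> B puts B to the right of A, A </> B puts B below A;
   <|> binds tighter than </>. *)
Notation "A <|> B" := (row_mx A B)
  (at level 61, right associativity) : ring_scope.
Notation "A </> B" := (col_mx A B)
  (at level 62, right associativity, format "A  </> '//' B") : ring_scope.

(* The library's \rank requires a commutative field.  Below, 'rV[F]_n is a left
   module over the possibly noncommutative F, and u *m A is the left linear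
   combination of the rows of A with coefficients u. *)
Definition left_row_space (F : nzRingType) (m n : nat) (A : 'M[F]_(m, n)) :
  set 'rV[F]_n := [set v | exists u : 'rV[F]_m, v = u *m A].

Definition left_row_free (F : nzRingType) (r n : nat) (Q : 'M[F]_(r, n)) : Prop :=
  forall u : 'rV[F]_r, u *m Q = 0 -> u = 0.

Definition is_left_basis (F : nzRingType) (r n : nat) (Q : 'M[F]_(r, n))
  (V : set 'rV[F]_n) : Prop :=
  left_row_free Q /\ left_row_space Q = V.

(* The number of elements of a basis; by left_rankP and left_rank_eq below it
   exists and is unique for row spaces over a division ring. *)
Definition left_dim (F : nzRingType) (n : nat) (V : set 'rV[F]_n) : nat :=
  xget 0%N [set r : nat | exists Q : 'M[F]_(r, n), is_left_basis Q V].

Definition left_rank (F : nzRingType) (m n : nat) (A : 'M[F]_(m, n)) : nat :=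
  left_dim (left_row_space A).

Lemma left_dependent (F : unitRingType) (divF : GRing.field_axiom F) (s r : nat)
  (P : 'M[F]_(r, s)) : (s < r)%N -> exists2 u : 'rV[F]_r, u != 0 & u *m P = 0.
Proof.
elim: s r P => [|s IHs] [|r] P // lt_sr.
  exists (const_mx 1); last exact: thinmx0.
  by apply/eqP => /matrixP/(_ 0 0)/eqP; rewrite !mxE oner_eq0.
have [[i0 Pi0] | P0] : (exists i : 'I_r.+1, P i 0 != 0) \/ forall i, P i 0 = 0.
  have [|noP] := pselect (exists i : 'I_r.+1, P i 0 != 0); [by left | right => i].
  by apply/eqP; apply: contra_notT noP => nz_Pi; exists i.
- have i0l j : (i0 == lift i0 j) = false by apply: negbTE; apply: neq_lift.
  have li0 j : (lift i0 j == i0) = false by rewrite eq_sym.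
  pose c j := P (lift i0 j) 0 * (P i0 0)^-1.
  pose E : 'M[F]_(r, r.+1) :=
    \matrix_(j, k) ((k == lift i0 j)%:R - (k == i0)%:R * c j).
  have EP j k : (E *m P) j k = P (lift i0 j) k - c j * P i0 k.
    rewrite mxE (bigD1 (lift i0 j)) //= (bigD1 i0) /= ?i0l //.
    rewrite big1 ?addr0 => [|i /andP[/negPf ne1 /negPf ne2]]; last first.
      by rewrite mxE ne1 ne2 mul0r subr0 mul0r.
    by rewrite !mxE !eqxx i0l li0 mul0r subr0 !mul1r sub0r mulNr.
  have [u nz_u uEP] := IHs r (@rsubmx F r 1 s (E *m P)) lt_sr.
  exists (u *m E).
    apply: contraNneq nz_u => uE0; apply/eqP/rowP => j.
    have /rowP/(_ (lift i0 j)) := uE0; rewrite !mxE => <-.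
    rewrite (bigD1 j) //= big1 ?addr0 => [|i ne_ij].
      by rewrite mxE eqxx li0 mul0r subr0 mulr1.
    rewrite mxE (inj_eq lift_inj) eq_sym (negPf ne_ij).
    by rewrite li0 mul0r subr0 mulr0.
  rewrite -mulmxA; apply/rowP => j; rewrite mxE [RHS]mxE.
  case: (split_ordP (m := 1) (n := s) j) => k ->.
    rewrite big1 // => i _; have -> : lshift s k = 0 by rewrite ord1; apply/val_inj.
    by rewrite EP /c mulrVK ?subrr ?mulr0 //; apply: divF.
  have /rowP/(_ k) := uEP; rewrite mxE [RHS]mxE => uk0; rewrite -[RHS]uk0.
  by apply: eq_bigr => i _; rewrite [in RHS]mxE.
- have [u nz_u uP] := IHs r.+1 (@rsubmx F r.+1 1 s P) (ltnW lt_sr).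
  exists u => //; apply/rowP => j; rewrite mxE [RHS]mxE.
  case: (split_ordP (m := 1) (n := s) j) => k ->.
    rewrite big1 // => i _; have -> : lshift s k = 0 by rewrite ord1; apply/val_inj.
    by rewrite P0 mulr0.
  have /rowP/(_ k) := uP; rewrite mxE [RHS]mxE => uk0; rewrite -[RHS]uk0.
  by apply: eq_bigr => i _; rewrite [in RHS]mxE.
Qed.

Lemma left_row_spaceM (F : nzRingType) (r m n : nat) (Q : 'M[F]_(r, n))
  (A : 'M[F]_(m, n)) :
  (left_row_space Q `<=` left_row_space A)%classic -> exists M, Q = M *m A.
Proof.
move=> sQA; have rowQ i : exists u : 'rV_m, row i Q = u *m A.
  by apply: sQA; exists (delta_mx 0 i); rewrite rowE.
have [f fP] := choice rowQ; exists (\matrix_i f i).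
by apply/row_matrixP => i; rewrite row_mul rowK.
Qed.

Lemma left_row_free_leq (F : unitRingType) (divF : GRing.field_axiom F)
  (r m n : nat) (Q : 'M[F]_(r, n)) (A : 'M[F]_(m, n)) :
  left_row_free Q -> (left_row_space Q `<=` left_row_space A)%classic -> (r <= m)%N.
Proof.
move=> freeQ /left_row_spaceM[M defQ]; rewrite leqNgt; apply/negP.
move=> /(left_dependent divF)-/(_ M)[u /eqP nz_u uM]; apply: nz_u; apply: freeQ.
by rewrite defQ mulmxA uM mul0mx.
Qed.

Lemma left_rankP (F : unitRingType) (divF : GRing.field_axiom F) (m n : nat)
  (A : 'M[F]_(m, n)) :
  exists Q : 'M[F]_(left_rank A, n), is_left_basis Q (left_row_space A).
Proof.
pose p r := `[< exists Q : 'M[F]_(r, n),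
  left_row_free Q /\ (left_row_space Q `<=` left_row_space A)%classic >].
have p0 : exists r, p r.
  exists 0%N; apply/asboolP; exists 0; split=> [u _|v [u ->]]; first exact: thinmx0.
  by exists 0; rewrite mulmx0 mul0mx.
have pm r : p r -> (r <= m)%N.
  by move=> /asboolP[Q [fQ sQ]]; apply: left_row_free_leq fQ sQ.
case: (ex_maxnP p0 pm) => r /asboolP[Q [freeQ sQA]] maxr.
suff basisQ : is_left_basis Q (left_row_space A).
  apply: (@xgetPex _ 0%N [set r : nat | exists Q : 'M[F]_(r, n),
                              is_left_basis Q (left_row_space A)]%classic).
  by exists r, Q.
split=> //; apply/seteqP; split=> // v Av; apply: contrapT => nQv.
suff /maxr : p (1 + r)%N by rewrite ltnn.
apply/asboolP; exists (col_mx v Q).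
split=> [u|w [u ->]]; rewrite -[u]hsubmxK mul_row_col.
  set a := lsubmx u; set b := rsubmx u; rewrite [a]mx11_scalar mul_scalar_mx.
  move=> avbQ; have a0 : a 0 0 = 0.
    apply: contra_notP nQv => /eqP nz_a; exists (- (a 0 0)^-1 *: b).
    rewrite -scalemxAl scaleNr; apply/eqP; rewrite -addr_eq0; apply/eqP.
    have := congr1 (GRing.scale (a 0 0)^-1) avbQ.
    by rewrite scalerDr scalerA mulVr ?divF // scale1r scaler0.
  move: avbQ; rewrite a0 scale0r add0r => /freeQ ->.
  by rewrite raddf0 row_mx0.
have [x ->] := Av; have [y ->] : left_row_space A (rsubmx u *m Q).
  by apply: sQA; exists (rsubmx u).
by exists (lsubmx u *m x + y); rewrite mulmxDl mulmxA.
Qed.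

Lemma left_rank_eq (F : unitRingType) (divF : GRing.field_axiom F) (m n r : nat)
  (A : 'M[F]_(m, n)) (Q : 'M[F]_(r, n)) :
  is_left_basis Q (left_row_space A) -> left_rank A = r.
Proof.
have [Q' [fQ' sQ']] := left_rankP divF A; move=> [fQ sQ].
apply/eqP; rewrite eqn_leq (left_row_free_leq divF fQ' (A := Q)) ?sQ' ?sQ //.
by rewrite (left_row_free_leq divF fQ (A := Q')) ?sQ' ?sQ.
Qed.

(* Main.v *)
(** Each of the ten equalities has, up to the order of the blocks, the form
    [r(0 R; L E) = r(L) + r(R)], which says that [x E y = 0] whenever [x L = 0]
    and [R y = 0].  Read [Phi], [Omega], [X], [Y] as sesquilinear forms on row
    vectors, [M(u, w) = u M w^*].  Since 2 is invertible a Hermitian solution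
    exists as soon as [X] has prescribed values on [c x d] and [d x c] and agrees
    with [Phi - B Y B^*] on [row A x row A], where [c = row C] and [d = row D^*];
    the ten conditions say that these prescriptions are compatible.

    A Hermitian [X0] with [C X0 D = Omega] reduces the problem to [Omega = 0].
    Then (i) [Y] is built so that [Phi - B Y B^*] descends to [row A] and
    vanishes where every form killing [c x d] and [d x c] must, and (ii) the
    resulting form on [row A] is extended to the whole space by zero on
    [c x d] and [d x c].  Both constructions only use retractions compatible
    with chains of subspaces. *)

Require Import Defs.
From mathcomp Require Import all_boot all_order all_algebra.
From mathcomp Require Import classical_sets.

Set Implicit Arguments.
Unset Strict Implicit.
Unset Printing Implicit Defensive.

Import GRing.Theory.
Local Open Scope ring_scope.


Lemma rows2 (T : Type) m1 m2 n1 n2 (L1 : 'M[T]_(m1, n1)) (R1 : 'M_(m1, n2))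
    (L2 : 'M_(m2, n1)) (R2 : 'M_(m2, n2)) :
  (L1 <|> R1 </> L2 <|> R2) = (L1 </> L2) <|> (R1 </> R2).
Proof. by rewrite -block_mxEv block_mxEh. Qed.

Lemma rows3 (T : Type) m1 m2 m3 n1 n2 (L1 : 'M[T]_(m1, n1)) (R1 : 'M_(m1, n2))
    (L2 : 'M_(m2, n1)) (R2 : 'M_(m2, n2)) (L3 : 'M_(m3, n1)) (R3 : 'M_(m3, n2)) :
  (L1 <|> R1 </> L2 <|> R2 </> L3 <|> R3) = (L1 </> L2 </> L3) <|> (R1 </> R2 </> R3).
Proof. by rewrite !rows2. Qed.

Lemma rows4 (T : Type) m1 m2 m3 m4 n1 n2 (L1 : 'M[T]_(m1, n1)) (R1 : 'M_(m1, n2))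
    (L2 : 'M_(m2, n1)) (R2 : 'M_(m2, n2)) (L3 : 'M_(m3, n1)) (R3 : 'M_(m3, n2))
    (L4 : 'M_(m4, n1)) (R4 : 'M_(m4, n2)) :
  (L1 <|> R1 </> L2 <|> R2 </> L3 <|> R3 </> L4 <|> R4)
    = (L1 </> L2 </> L3 </> L4) <|> (R1 </> R2 </> R3 </> R4).
Proof. by rewrite !rows2. Qed.

Section ConjugateTranspose.

Context (F : nzRingType) (star : F -> F).
Hypothesis star_inv : involutive_antiautomorphism star.

Let starD : {morph star : x y / x + y}. Proof. by case: star_inv. Qed.
Let starM : {morph star : x y / x * y >-> y * x}. Proof. by case: star_inv. Qed.
Let starK : involutive star. Proof. by case: star_inv. Qed.

Let star0 : star 0 = 0.
Proof. by apply: (addrI (star 0)); rewrite -starD !addr0. Qed.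

Lemma star1 : star 1 = 1.
Proof. by rewrite -[LHS]mulr1 -[X in _ * X]starK -starM mulr1 starK. Qed.

Let starN : {morph star : x / - x}.
Proof. by move=> x; apply/eqP; rewrite -addr_eq0 -starD addNr star0. Qed.

Lemma eq0_rowP m n (M : 'M[F]_(m, n)) : (forall u : 'rV_m, u *m M = 0) -> M = 0.
Proof. by move=> M0; apply/row_matrixP => i; rewrite rowE M0 row0. Qed.

Lemma conjtrmxK m n (A : 'M[F]_(m, n)) : (A^^star)^^star = A.
Proof. by apply/matrixP => i j; rewrite !mxE starK. Qed.

Lemma conjtrmx_inj m n : injective (@conjtrmx F star m n).
Proof. exact: can_inj (@conjtrmxK m n). Qed.

Lemma conjtrmx0 m n : (0 : 'M[F]_(m, n))^^star = 0.
Proof. by apply/matrixP => i j; rewrite !mxE star0. Qed.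

Lemma conjtrmxD m n (A B : 'M[F]_(m, n)) : (A + B)^^star = A^^star + B^^star.
Proof. by apply/matrixP => i j; rewrite !mxE starD. Qed.

Lemma conjtrmxN m n (A : 'M[F]_(m, n)) : (- A)^^star = - A^^star.
Proof. by apply/matrixP => i j; rewrite !mxE starN. Qed.

Lemma conjtrmxB m n (A B : 'M[F]_(m, n)) : (A - B)^^star = A^^star - B^^star.
Proof. by rewrite conjtrmxD conjtrmxN. Qed.

Lemma conjtrmxM m n p (A : 'M[F]_(m, n)) (B : 'M[F]_(n, p)) :
  (A *m B)^^star = B^^star *m A^^star.
Proof.
apply/matrixP => i j; rewrite !mxE (big_morph star starD star0).
by apply: eq_bigr => k _; rewrite !mxE starM.
Qed.

Lemma conjtrmx1 n : (1%:M : 'M[F]_n)^^star = 1%:M.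
Proof.
apply/matrixP => i j; rewrite !mxE [j == i]eq_sym.
by case: (i == j); rewrite ?star1 ?star0.
Qed.

Lemma conjtrmx_row m n1 n2 (A : 'M[F]_(m, n1)) (B : 'M[F]_(m, n2)) :
  (A <|> B)^^star = A^^star </> B^^star.
Proof. by rewrite /conjtrmx tr_row_mx map_col_mx. Qed.

Lemma conjtrmx_col m1 m2 n (A : 'M[F]_(m1, n)) (B : 'M[F]_(m2, n)) :
  (A </> B)^^star = A^^star <|> B^^star.
Proof. by rewrite /conjtrmx tr_col_mx map_row_mx. Qed.

Definition mxform m n (M : 'M[F]_(m, n)) (u : 'rV_m) (w : 'rV_n) : 'M[F]_1 :=
  u *m M *m w^^star.

Lemma mxformBl m n (M : 'M[F]_(m, n)) u u' w :
  mxform M (u - u') w = mxform M u w - mxform M u' w.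
Proof. by rewrite /mxform !mulmxBl. Qed.

Lemma mxformBr m n (M : 'M[F]_(m, n)) u w w' :
  mxform M u (w - w') = mxform M u w - mxform M u w'.
Proof. by rewrite /mxform conjtrmxB // mulmxBr. Qed.

Lemma mxformDr m n (M : 'M[F]_(m, n)) u w w' :
  mxform M u (w + w') = mxform M u w + mxform M u w'.
Proof. by rewrite /mxform conjtrmxD // mulmxDr. Qed.

Lemma mxform0l m n (M : 'M[F]_(m, n)) w : mxform M 0 w = 0.
Proof. by rewrite /mxform !mul0mx. Qed.

Lemma mxform0r m n (M : 'M[F]_(m, n)) u : mxform M u 0 = 0.
Proof. by rewrite /mxform conjtrmx0 // mulmx0. Qed.

Lemma mxformD m n (M N : 'M[F]_(m, n)) u w : mxform (M + N) u w = mxform M u w + mxform N u w.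
Proof. by rewrite /mxform mulmxDr mulmxDl. Qed.

Lemma mxformN m n (M : 'M[F]_(m, n)) u w : mxform (- M) u w = - mxform M u w.
Proof. by rewrite /mxform mulmxN mulNmx. Qed.

Lemma mxformB m n (M N : 'M[F]_(m, n)) u w : mxform (M - N) u w = mxform M u w - mxform N u w.
Proof. by rewrite mxformD mxformN. Qed.

Lemma mxform_mul m n p q (M : 'M[F]_(p, q)) (T : 'M_(m, p)) (U : 'M_(n, q)) u w :
  mxform (T *m M *m U^^star) u w = mxform M (u *m T) (w *m U).
Proof. by rewrite /mxform conjtrmxM // !mulmxA. Qed.

Lemma mxform_hermitian n (M : 'M[F]_n) u w :
  is_hermitian star M -> mxform M u w = (mxform M w u)^^star.
Proof. by move=> hM; rewrite /mxform !conjtrmxM // conjtrmxK // -hM mulmxA. Qed.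

Lemma mxform_shift m n (M : 'M[F]_(m, n)) u u' w w' :
  mxform M (u - u') w' = 0 -> mxform M u (w - w') = 0 -> mxform M u' w' = mxform M u w.
Proof.
rewrite mxformBl mxformBr => /eqP; rewrite subr_eq0 => /eqP <- /eqP.
by rewrite subr_eq0 => /eqP <-.
Qed.

Lemma mxform_conj m n (M : 'M[F]_(m, n)) u w : mxform (M^^star) u w = (mxform M w u)^^star.
Proof. by rewrite /mxform !conjtrmxM // conjtrmxK // mulmxA. Qed.

Lemma mxform_col m1 m2 n (M1 : 'M[F]_(m1, n)) (M2 : 'M_(m2, n)) x1 x2 w :
  mxform (M1 </> M2) (x1 <|> x2) w = mxform M1 x1 w + mxform M2 x2 w.
Proof. by rewrite /mxform mul_row_col mulmxDl. Qed.

Lemma mxform_row m n1 n2 (M1 : 'M[F]_(m, n1)) (M2 : 'M_(m, n2)) x w1 w2 :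
  mxform (M1 <|> M2) x (w1 <|> w2) = mxform M1 x w1 + mxform M2 x w2.
Proof. by rewrite /mxform conjtrmx_row mul_mx_row mul_row_col. Qed.

Lemma mxform0 m n x w : mxform (0 : 'M[F]_(m, n)) x w = 0.
Proof. by rewrite /mxform mulmx0 mul0mx. Qed.

Lemma mxformNl m n (M : 'M[F]_(m, n)) x w : mxform M (- x) w = - mxform M x w.
Proof. by rewrite /mxform !mulNmx. Qed.

Lemma mxformNr m n (M : 'M[F]_(m, n)) x w : mxform M x (- w) = - mxform M x w.
Proof. by rewrite /mxform conjtrmxN // mulmxN. Qed.

Lemma mxform_eq0P m n (M : 'M[F]_(m, n)) :
  (forall u w, mxform M u w = 0) -> M = 0.
Proof.
move=> M0; apply: eq0_rowP => u; apply: conjtrmx_inj.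
rewrite conjtrmx0 //; apply: eq0_rowP => w; apply: conjtrmx_inj.
by rewrite conjtrmxM conjtrmxK conjtrmx0; apply: M0.
Qed.

End ConjugateTranspose.

Section Rank.

Context (F : unitRingType) (divF : GRing.field_axiom F).

Lemma inner_inverse_ex m n (M : 'M[F]_(m, n)) : exists G, M *m G *m M = M.
Proof.
elim: m M => [|m IHm] M; first by exists 0; rewrite [LHS]flatmx0 [RHS]flatmx0.
rewrite -[M](@vsubmxK _ 1 m); move: (@usubmx _ 1 m _ M) (@dsubmx _ 1 m _ M) => w N.
have [G NGN] := IHm N.
suff: exists G : 'M_(n, 1 + m), col_mx w N *m G *m col_mx w N = col_mx w N by [].
have NGN0 : N *m (1%:M - G *m N) = 0 by rewrite mulmxBr mulmx1 mulmxA NGN subrr.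
pose v := w *m (1%:M - G *m N).
have [v0|[j vj]] : v = 0 \/ exists j, v 0 j != 0.
  have [->|/rV0Pn[j vj]] := eqVneq v 0; by [left | right; exists j].
  exists (row_mx (0 : 'cV_n) G); rewrite mul_mx_row mulmx0 mul_row_col mul0mx add0r.
  rewrite !mul_col_mx NGN -mulmxA; congr col_mx.
  by move/eqP: v0; rewrite /v mulmxBr mulmx1 subr_eq0 => /eqP <-.
pose t : 'cV[F]_n := \col_i ((i == j)%:R * (v 0 j)^-1).
have vt1 : v *m t = 1%:M.
  clearbody v.
  apply/rowP => i; rewrite !ord1 !mxE (bigD1 j) //= big1 => [|l /negPf nlj].
    by rewrite !mxE ?eqxx ?mul1r addr0 mulrV ?divF.
  by rewrite !mxE nlj mul0r mulr0.
pose g := (1%:M - G *m N) *m t.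
have wg : w *m g = 1%:M by rewrite mulmxA vt1.
have Ng : N *m g = 0 by rewrite mulmxA NGN0 mul0mx.
exists (row_mx g (G - g *m (w *m G))).
rewrite mul_mx_row mul_row_col !mul_col_mx wg Ng.
rewrite [w *m (G - _)]mulmxBr [N *m (G - _)]mulmxBr !(mulmxA _ g) wg Ng mul1mx.
by rewrite !(mul0mx, mul1mx) subrr subr0 mul0mx NGN add_col_mx addr0 add0r.
Qed.

(* An arbitrary inner inverse; neither unique nor a Moore-Penrose inverse. *)
Definition pinv m n (M : 'M[F]_(m, n)) : 'M[F]_(n, m) :=
  xget 0 [set G | M *m G *m M = M]%classic.

Lemma mulmx_pinv m n (M : 'M[F]_(m, n)) : M *m pinv M *m M = M.
Proof. by rewrite /pinv; apply: (xgetPex 0 (inner_inverse_ex M)). Qed.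

Lemma lker_pinv m n (M : 'M[F]_(m, n)) : (1%:M - M *m pinv M) *m M = 0.
Proof. by rewrite mulmxBl mul1mx mulmx_pinv subrr. Qed.

Lemma rker_pinv m n (M : 'M[F]_(m, n)) : M *m (1%:M - pinv M *m M) = 0.
Proof. by rewrite mulmxBr mulmx1 mulmxA mulmx_pinv subrr. Qed.

Lemma left_row_free_rinv r n (Q : 'M[F]_(r, n)) :
  left_row_free Q -> Q *m pinv Q = 1%:M.
Proof.
move=> freeQ; apply/esym/eqP; rewrite -subr_eq0; apply/eqP/eq0_rowP => u.
by apply: freeQ; rewrite -mulmxA lker_pinv mulmx0.
Qed.

Lemma rinv_left_row_free r n (Q : 'M[F]_(r, n)) T : Q *m T = 1%:M -> left_row_free Q.
Proof. by move=> QT u uQ; rewrite -[u]mulmx1 -QT mulmxA uQ mul0mx. Qed.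

Lemma left_row_spaceP m n (M : 'M[F]_(m, n)) (v : 'rV[F]_n) :
  left_row_space M v <-> v *m (1%:M - pinv M *m M) = 0.
Proof.
split=> [[u ->]|]; first by rewrite -mulmxA rker_pinv mulmx0.
rewrite mulmxBr mulmx1 => /eqP; rewrite subr_eq0 => /eqP ->.
by exists (v *m pinv M); rewrite mulmxA.
Qed.

Lemma sub_left_row_space r m n (N : 'M[F]_(r, n)) (M : 'M[F]_(m, n)) T :
  N = T *m M -> (left_row_space N `<=` left_row_space M)%classic.
Proof. by move=> -> v [u ->]; exists (u *m T); rewrite mulmxA. Qed.

Lemma left_rank_factor m n (M : 'M[F]_(m, n)) :
  exists P Q (S : 'M[F]_(left_rank M, m)) T,
    [/\ M = P *m Q, Q = S *m M, S *m P = 1%:M & Q *m T = 1%:M].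
Proof.
have [Q [freeQ eqQM]] := left_rankP divF M.
have QT := left_row_free_rinv freeQ.
have [P defM] : exists P, M = P *m Q by apply: left_row_spaceM; rewrite eqQM.
have [S defQ] : exists S, Q = S *m M by apply: left_row_spaceM; rewrite eqQM.
exists P, Q, S, (pinv Q); split=> //.
by rewrite -[S *m P]mulmx1 -QT mulmxA -(mulmxA S) -defM -defQ.
Qed.

Lemma factor_left_rank m n r (M : 'M[F]_(m, n)) (P : 'M_(m, r)) (Q : 'M_(r, n)) S T :
  M = P *m Q -> S *m P = 1%:M -> Q *m T = 1%:M -> left_rank M = r.
Proof.
move=> defM SP QT; apply: (left_rank_eq divF (Q := Q)).
split; first exact: rinv_left_row_free QT.
apply/seteqP; split; last exact: sub_left_row_space defM.
by apply: (@sub_left_row_space _ _ _ _ _ S); rewrite defM mulmxA SP mul1mx.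
Qed.

Lemma left_rankS m1 m2 n (M : 'M[F]_(m1, n)) (N : 'M[F]_(m2, n)) :
  (left_row_space M `<=` left_row_space N)%classic -> (left_rank M <= left_rank N)%N.
Proof.
move=> sMN; have [Q [freeQ eqQM]] := left_rankP divF M.
have [Q' [_ eqQN]] := left_rankP divF N.
by apply: (left_row_free_leq divF freeQ (A := Q')); rewrite eqQM eqQN.
Qed.

Lemma left_rank_mull k m n (P : 'M[F]_(k, m)) (M : 'M[F]_(m, n)) :
  (left_rank (P *m M) <= left_rank M)%N.
Proof. exact/left_rankS/(@sub_left_row_space _ _ _ _ _ P). Qed.

Lemma left_rank_mulr m n k (M : 'M[F]_(m, n)) (G : 'M[F]_(n, k)) :
  (left_rank (M *m G) <= left_rank M)%N.
Proof.
have [P [Q [_ [_ [defM _ _ _]]]]] := left_rank_factor M.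
have [Q' [freeQ' eqQ']] := left_rankP divF (M *m G).
apply: (left_row_free_leq divF freeQ' (A := Q *m G)); rewrite eqQ'.
by apply: (@sub_left_row_space _ _ _ _ _ P); rewrite mulmxA -defM.
Qed.

Lemma left_rank_mul_rinv m n k (M : 'M[F]_(m, n)) (G : 'M[F]_(n, k)) H :
  G *m H = 1%:M -> left_rank (M *m G) = left_rank M.
Proof.
move=> GH; apply/eqP; rewrite eqn_leq left_rank_mulr /=.
by rewrite -{1}[M]mulmx1 -GH mulmxA left_rank_mulr.
Qed.

Lemma left_row_space_rank m1 m2 n (M : 'M[F]_(m1, n)) (N : 'M[F]_(m2, n)) :
    (left_row_space M `<=` left_row_space N)%classic -> left_rank M = left_rank N ->
  (left_row_space N `<=` left_row_space M)%classic.
Proof.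
move=> sMN eqr v Nv.
have [Q [freeQ eqQM]] := left_rankP divF M.
have [Q' [_ eqQN]] := left_rankP divF N.
have [T defT] : exists T, col_mx v Q = T *m Q'.
  apply: left_row_spaceM => w [u ->]; rewrite eqQN -[u]hsubmxK mul_row_col.
  have [y ->] := Nv; have [z ->] : left_row_space N (rsubmx u *m Q).
    by apply: sMN; rewrite -eqQM; exists (rsubmx u).
  by exists (lsubmx u *m y + z); rewrite mulmxDl mulmxA.
have lt_r : (left_rank N < 1 + left_rank M)%N by rewrite eqr.
have [u /eqP nz_u uT] := left_dependent divF T lt_r.
rewrite -eqQM.
have := congr1 (mulmx u) defT; rewrite mulmxA uT mul0mx -[u]hsubmxK mul_row_col.
set a := lsubmx u; set b := rsubmx u; rewrite [a]mx11_scalar mul_scalar_mx.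
have [a0|nz_a] := eqVneq (a 0 0) 0.
  rewrite a0 scale0r add0r => /freeQ b0; case: nz_u.
  by rewrite -[u]hsubmxK -/a -/b b0 [a]mx11_scalar a0 raddf0 row_mx0.
move=> avbQ; exists (- (a 0 0)^-1 *: b); rewrite -scalemxAl scaleNr; apply/eqP.
rewrite -addr_eq0; apply/eqP; have := congr1 (GRing.scale (a 0 0)^-1) avbQ.
by rewrite scalerDr scalerA mulVr ?divF // scale1r scaler0.
Qed.

End Rank.

Section BlockRank.

Context (F : unitRingType) (divF : GRing.field_axiom F) (star : F -> F).
Hypothesis star_inv : involutive_antiautomorphism star.
Local Notation form := (mxform star).

Lemma left_rank_conjtrmx m n (M : 'M[F]_(m, n)) : left_rank (M^^star) = left_rank M.
Proof.
have [P [Q [S [T [defM _ SP QT]]]]] := left_rank_factor divF M.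
apply: (factor_left_rank divF (P := Q^^star) (Q := P^^star)
          (S := T^^star) (T := S^^star)).
- by rewrite -conjtrmxM // -defM.
- by rewrite -conjtrmxM // QT conjtrmx1.
- by rewrite -conjtrmxM // SP conjtrmx1.
Qed.

Lemma left_rank_block0 m1 m2 n1 n2 (R : 'M[F]_(m1, n2)) (L : 'M[F]_(m2, n1)) Z Z' :
  left_rank (block_mx 0 R L (L *m Z + Z' *m R)) = (left_rank L + left_rank R)%N.
Proof.
have [P1 [Q1 [S1 [T1 [defL _ SP1 QT1]]]]] := left_rank_factor divF L.
have [P2 [Q2 [S2 [T2 [defR _ SP2 QT2]]]]] := left_rank_factor divF R.
apply: (factor_left_rank divF (P := block_mx 0 P2 P1 (Z' *m P2))
         (Q := block_mx Q1 (Q1 *m Z) 0 Q2) (S := block_mx (- (S1 *m Z')) S1 S2 0)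
         (T := block_mx T1 (- (Z *m T2)) 0 T2)); rewrite mulmx_block.
- by rewrite !(mul0mx, mulmx0) !addr0 !add0r mulmxA -(mulmxA Z') -defL -defR.
- rewrite !(mul0mx, mulmx0) !addr0 !add0r SP1 SP2 mulNmx -!mulmxA addNr.
  by rewrite -scalar_mx_block.
- rewrite !(mul0mx, mulmx0) !addr0 !add0r QT1 QT2 mulmxN !mulmxA addNr.
  by rewrite -scalar_mx_block.
Qed.

Lemma left_rank_blockP m1 m2 n1 n2 (R : 'M[F]_(m1, n2)) (L : 'M[F]_(m2, n1)) E :
  left_rank (block_mx 0 R L E) = (left_rank L + left_rank R)%N <->
  forall x w, x *m L = 0 -> w *m R^^star = 0 -> form E x w = 0.
Proof.
pose E' := (1%:M - L *m pinv L) *m E *m (1%:M - pinv R *m R).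
have defE : E = L *m (pinv L *m E) + (1%:M - L *m pinv L) *m E *m pinv R *m R + E'.
  rewrite -addrA [X in _ + X]addrC /E' [_ *m (1%:M - pinv R *m R)]mulmxBr mulmx1 !mulmxA subrK.
  by rewrite mulmxBl mul1mx addrC subrK.
split=> [eqr x w xL wR | KE]; last first.
  have E'0 : E' = 0.
    apply: (mxform_eq0P star_inv) => u v.
    have := KE (u *m (1%:M - L *m pinv L)) (v *m (1%:M - pinv R *m R)^^star).
    rewrite /mxform -!mulmxA lker_pinv // mulmx0 -conjtrmxM // rker_pinv //.
    rewrite conjtrmx0 // mulmx0.
    by rewrite conjtrmxM // conjtrmxK // => /(_ erefl erefl) <-; rewrite /E' !mulmxA.
  by rewrite defE E'0 addr0 left_rank_block0.
have Rw : R *m w^^star = 0.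
  by apply: (conjtrmx_inj star_inv); rewrite conjtrmxM // conjtrmxK // wR conjtrmx0.
suff E'0 : E' = 0.
  rewrite /mxform defE E'0 addr0 mulmxDr (mulmxA x L) xL mul0mx add0r -!mulmxA Rw.
  by rewrite !mulmx0.
pose M := block_mx 0 R L E; pose M' := block_mx 0 R L E'; pose N := block_mx 0 R L 0.
have rN : left_rank N = (left_rank L + left_rank R)%N.
  by have := left_rank_block0 R L 0 0; rewrite mulmx0 mul0mx addr0.
have LE' : L *m pinv L *m E' = 0.
  rewrite /E' !mulmxA [_ *m (1%:M - L *m _)]mulmxBr mulmx1 mulmxA mulmx_pinv //.
  by rewrite subrr !mul0mx.
have sNM' : (left_row_space N `<=` left_row_space M')%classic.
  apply: (@sub_left_row_space _ _ _ _ _ _ (block_mx 1%:M 0 0 (L *m pinv L))).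
  rewrite mulmx_block !(mul0mx, mulmx0, mul1mx, addr0, add0r) LE'.
  by rewrite mulmx_pinv.
have defM' : M' = block_mx 1%:M 0 (- ((1%:M - L *m pinv L) *m E *m pinv R)) 1%:M
                  *m M *m block_mx 1%:M (- (pinv L *m E)) 0 1%:M.
  rewrite !mulmx_block !(mul0mx, mulmx0, mul1mx, mulmx1, addr0, add0r).
  congr block_mx; rewrite /E' mulmxBr mulmx1 mulmxN mulNmx !mulmxA.
  by rewrite mulmxBl mul1mx addrA [RHS]addrC addrA.
have r_eq : left_rank N = left_rank M'.
  apply/eqP; rewrite eqn_leq left_rankS //= rN -eqr defM'.
  by apply: leq_trans (left_rank_mulr _ _ _) (left_rank_mull _ _ _).
apply: eq0_rowP => u.
have [|v] := left_row_space_rank divF sNM' r_eq (t := row_mx 0 u *m M').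
  by exists (row_mx 0 u).
rewrite -[v]hsubmxK !mul_row_block !(mul0mx, mulmx0, add0r, addr0).
move=> /eq_row_mx[_ uE']; have E'0 : E' *m (1%:M - pinv R *m R) = E'.
  rewrite /E' -[LHS]mulmxA; congr (_ *m _).
  by rewrite [_ *m (1%:M - _)]mulmxBr mulmx1 mulmxBl mul1mx -!mulmxA [R *m _]mulmxA
             mulmx_pinv // subrr subr0.
by rewrite -E'0 mulmxA uE' -mulmxA rker_pinv // mulmx0.
Qed.

End BlockRank.

Section Subspaces.

Context (F : unitRingType) (divF : GRing.field_axiom F).

Definition subspace n (S : 'rV[F]_n -> Prop) : Prop :=
  exists k (M : 'M[F]_(k, n)), forall v, S v <-> left_row_space M v.

Lemma subspace_row k n (M : 'M[F]_(k, n)) : subspace (left_row_space M).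
Proof. by exists k, M. Qed.

Lemma subspace_ker n k (N : 'M[F]_(n, k)) : subspace (fun v => v *m N = 0).
Proof.
exists n, (1%:M - N *m pinv N) => v; split=> [vN|[u ->]].
  by exists v; rewrite mulmxBr mulmx1 mulmxA vN mul0mx subr0.
by rewrite -mulmxA lker_pinv // mulmx0.
Qed.

Lemma subspace_as_ker n (S : 'rV[F]_n -> Prop) :
  subspace S -> exists N : 'M[F]_n, forall v, S v <-> v *m N = 0.
Proof.
case=> k [M SM]; exists (1%:M - pinv M *m M) => v.
by rewrite SM left_row_spaceP.
Qed.

Lemma subspaceI n (S T : 'rV[F]_n -> Prop) :
  subspace S -> subspace T -> subspace (fun v => S v /\ T v).
Proof.
move=> /subspace_as_ker[M SM] /subspace_as_ker[N TN].
have [k [K KP]] := subspace_ker (row_mx M N).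
exists k, K => v; rewrite -KP mul_mx_row SM TN.
split=> [[-> ->]|]; first by rewrite row_mx0.
by rewrite -(row_mx0 F 1 n n) => /eq_row_mx.
Qed.

Lemma subspaceD n (S T : 'rV[F]_n -> Prop) :
  subspace S -> subspace T -> subspace (fun v => exists2 u, S u & T (v - u)).
Proof.
move=> [k [M SM]] [l [N TN]]; exists (k + l)%N, (col_mx M N) => v; split.
  move=> [u /SM[x ux] /TN[y vuy]]; exists (row_mx x y).
  by rewrite mul_row_col -ux -vuy addrC subrK.
move=> [u ->]; rewrite -[u]hsubmxK mul_row_col; exists (lsubmx u *m M).
  by apply/SM; exists (lsubmx u).
by apply/TN; exists (rsubmx u); rewrite addrC addKr.
Qed.

Lemma subspace_preim m n (A : 'M[F]_(m, n)) (S : 'rV[F]_n -> Prop) :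
  subspace S -> subspace (fun v => S (v *m A)).
Proof.
move=> /subspace_as_ker[N SN]; have [k [K KP]] := subspace_ker (A *m N).
by exists k, K => v; rewrite -KP SN mulmxA.
Qed.

Lemma subspace_sub n (S : 'rV[F]_n -> Prop) u v :
  subspace S -> S u -> S v -> S (u - v).
Proof.
by move=> [k [M SM]] /SM[x ->] /SM[y ->]; apply/SM; exists (x - y); rewrite mulmxBl.
Qed.

Lemma subspace0 n (S : 'rV[F]_n -> Prop) : subspace S -> S 0.
Proof. by move=> [k [M SM]]; apply/SM; exists 0; rewrite mul0mx. Qed.

Lemma subspace_opp n (S : 'rV[F]_n -> Prop) u : subspace S -> S u -> S (- u).
Proof. by move=> sS Su; rewrite -sub0r; apply: subspace_sub => //; apply: subspace0. Qed.

(* A projection onto a complement of the intersection of [C] and [D] in [D],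
   along a subspace that contains [C]. *)
Lemma complement_proj n (C D : 'rV[F]_n -> Prop) : subspace C -> subspace D ->
  exists P : 'M[F]_n, [/\ forall v, C v -> v *m P = 0, forall v, D (v *m P)
                        & forall v, D v -> C (v - v *m P)].
Proof.
move=> /subspace_as_ker[N CN] [k [M DM]].
exists (N *m pinv (M *m N) *m M); split=> [v /CN vN | v | v /DM[u ->]].
- by rewrite !mulmxA vN !mul0mx.
- by apply/DM; exists (v *m (N *m pinv (M *m N))); rewrite !mulmxA.
- apply/CN; rewrite mulmxBl -!mulmxA (mulmxA M) [in X in _ - X](mulmxA (M *m N)).
  by rewrite mulmx_pinv // subrr.
Qed.

Definition retracts n (b : 'rV[F]_n -> Prop) (s : 'rV[F]_n -> Prop) (rho : 'M[F]_n) :=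
  forall v, s v -> b (v *m rho) /\ s (v *m rho).

Lemma retraction_ex n (b : 'rV[F]_n -> Prop) : subspace b ->
  exists2 rho : 'M[F]_n, (forall v, b v -> v *m rho = v) & retracts b (fun=> True) rho.
Proof.
move=> [k [M bM]]; exists (pinv M *m M) => [v /bM/(left_row_spaceP divF)|v _].
  by rewrite mulmxBr mulmx1 => /eqP; rewrite subr_eq0 => /eqP.
by split=> //; apply/bM; exists (v *m pinv M); rewrite mulmxA.
Qed.

(* Iterated along a chain of subspaces, from the largest to the smallest, this
   gives a retraction onto [b] that preserves every member of the chain. *)
Lemma retraction_refine n (b s : 'rV[F]_n -> Prop) rho :
    subspace b -> subspace s -> (forall v, b v -> v *m rho = v) ->
  exists rho' : 'M[F]_n, [/\ forall v, b v -> v *m rho' = v, retracts b s rho'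
    & forall t, subspace t -> (forall v, s v -> t v) -> retracts b t rho ->
        retracts b t rho'].
Proof.
move=> sb ss rho_id; have [P [bP Ps sP]] := complement_proj sb ss.
exists ((1%:M - P) *m rho).
have muE v : v *m ((1%:M - P) *m rho) = (v - v *m P) *m rho.
  by rewrite mulmxA mulmxBr mulmx1.
split=> [v bv|v sv|t st sub_st rt v tv]; rewrite muE.
- by rewrite bP // subr0 rho_id.
- by rewrite rho_id; [split; [exact: sP | exact: subspace_sub] | exact: sP].
- by apply: rt; apply: subspace_sub => //; apply: sub_st.
Qed.

End Subspaces.

Section Forms.

Context (F : unitRingType) (divF : GRing.field_axiom F) (star : F -> F).
Hypothesis star_inv : involutive_antiautomorphism star.
Local Notation form := (mxform star).

Lemma split_chain n (h k e c f : 'rV[F]_n -> Prop) :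
    subspace h -> subspace k -> subspace e -> subspace c -> subspace f ->
    (forall v, k v -> e v) -> (forall v, e v -> c v) -> (forall v, c v -> f v) ->
  exists T : 'M[F]_n,
    [/\ forall v, h v -> v *m T = 0, forall v, h (v - v *m T),
        forall v, k v -> k (v *m T), forall v, e v -> e (v *m T)
      & (forall v, c v -> c (v *m T)) /\ (forall v, f v -> f (v *m T))].
Proof.
move=> sh sk se sc sf ke ec cf.
have [r0 id0 r0T] := retraction_ex divF sh.
have [r1 [id1 r1f r1P]] := retraction_refine divF sh sf id0.
have [r2 [id2 r2c r2P]] := retraction_refine divF sh sc id1.
have [r3 [id3 r3e r3P]] := retraction_refine divF sh se id2.
have [r4 [id4 r4k r4P]] := retraction_refine divF sh sk id3.
have sT : subspace (fun _ : 'rV[F]_n => True).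
  by exists n, 1%:M => v; split=> // _; exists v; rewrite mulmx1.
have r4T : retracts h (fun=> True) r4 by auto 10.
have r4f : retracts h f r4 by auto 10.
have r4c : retracts h c r4 by auto 10.
have r4e : retracts h e r4 by auto 10.
have sub_r4 t v : subspace t -> retracts h t r4 -> t v -> t (v - v *m r4).
  by move=> st rt tv; apply: subspace_sub => //; case: (rt v tv).
have TE v : v *m (1%:M - r4) = v - v *m r4 by rewrite mulmxBr mulmx1.
exists (1%:M - r4); split=> [v hv|v|v|v|]; last split=> v.
all: rewrite TE.
- by rewrite id4 ?subrr.
- by rewrite subKr; case: (r4T v).
- exact: sub_r4 sk r4k.
- exact: sub_r4 se r4e.
- exact: sub_r4 sc r4c.
- exact: sub_r4 sf r4f.
Qed.

(* Here [h = ker B] and [k = ker A], while [c], [d], [e] and [f] are the preimages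
   under [A] of [row C], [row D^*], their intersection and their sum.  A first
   form [Tc Phi Td^*] is right on every prescribed block but [d x c]; the error
   [Phi1] made there vanishes on [d :&: (c + h)] times [c :&: (d + h)] by the last
   hypothesis, so it can be corrected with projections [Pd] and [Pc] that kill
   [c + h] and [d + h]. *)
Lemma mxform_descend n (Phi : 'M[F]_n) (h k e c d f : 'rV[F]_n -> Prop) :
    is_hermitian star Phi ->
    subspace h -> subspace k -> subspace e -> subspace c -> subspace d -> subspace f ->
    (forall v, k v -> e v) -> (forall v, e v -> c v) -> (forall v, e v -> d v) ->
    (forall v, c v -> f v) -> (forall v, d v -> f v) ->
    (forall u w, k u -> h w -> form Phi u w = 0) ->
    (forall u w, k u -> h u -> form Phi u w = 0) ->
    (forall u w, h u -> c u -> d w -> form Phi u w = 0) ->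
    (forall u w, h u -> d u -> c w -> form Phi u w = 0) ->
    (forall u w, e u -> f w -> h w -> form Phi u w = 0) ->
    (forall u w, e u -> h u -> f w -> form Phi u w = 0) ->
    (forall uc ud wc wd, c uc -> d ud -> h (ud - uc) -> c wc -> d wd -> h (wd - wc) ->
       form Phi uc wd = form Phi ud wc) ->
  exists Theta : 'M[F]_n,
    [/\ forall u w, h u \/ h w -> form Theta u w = 0,
        forall u w, k u \/ k w -> form Theta u w = form Phi u w,
        forall u w, c u -> d w -> form Theta u w = form Phi u w,
        forall u w, d u -> c w -> form Theta u w = form Phi u w
      & forall u w, e u /\ f w \/ f u /\ e w -> form Theta u w = form Phi u w].
Proof.
move=> hPhi sh sk se sc sd sf ke ec ed cf df H1 H2 H6 H6' H8 H9 H10.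
have sym u w : form Phi w u = 0 -> form Phi u w = 0.
  by rewrite (mxform_hermitian star_inv u w hPhi) => ->; rewrite (conjtrmx0 star_inv).
have [Tc [Tc0 Tch Tck Tce [Tcc Tcf]]] := split_chain sh sk se sc sf ke ec cf.
have [Td [Td0 Tdh Tdk Tde [Tdd Tdf]]] := split_chain sh sk se sd sf ke ed df.
have [Pc [Pc0 Pcc Pcd]] := complement_proj divF (subspaceD sd sh) sc.
have [Pd [Pd0 Pdd Pdc]] := complement_proj divF (subspaceD sc sh) sd.
have Pc0d v : d v -> v *m Pc = 0.
  by move=> dv; apply: Pc0; exists v => //; rewrite subrr; apply: subspace0.
have Pc0h v : h v -> v *m Pc = 0.
  by move=> hv; apply: Pc0; exists 0; rewrite ?subr0 //; apply: subspace0.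
have Pd0c v : c v -> v *m Pd = 0.
  by move=> cv; apply: Pd0; exists v => //; rewrite subrr; apply: subspace0.
have Pd0h v : h v -> v *m Pd = 0.
  by move=> hv; apply: Pd0; exists 0; rewrite ?subr0 //; apply: subspace0.
have sT (s : 'rV[F]_n -> Prop) T : subspace s ->
  (forall v, s v -> s (v *m T)) -> forall v, s v -> s (v - v *m T).
  by move=> ss sT v sv; apply: subspace_sub => //; apply: sT.
have Tck' := sT _ _ sk Tck; have Tce' := sT _ _ se Tce.
have Tcc' := sT _ _ sc Tcc; have Tcf' := sT _ _ sf Tcf.
have Tdk' := sT _ _ sk Tdk; have Tde' := sT _ _ se Tde.
have Tdd' := sT _ _ sd Tdd; have Tdf' := sT _ _ sf Tdf.
pose Phi1 := Phi - Tc *m Phi *m Td^^star.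
have Phi1E u w : form Phi1 u w = form Phi u w - form Phi (u *m Tc) (w *m Td).
  by rewrite mxformB (mxform_mul star_inv).
clearbody Phi1.
have Phi1_0 u w : form Phi (u - u *m Tc) (w *m Td) = 0 ->
    form Phi u (w - w *m Td) = 0 -> form Phi1 u w = 0.
  by move=> uT wT; rewrite Phi1E (mxform_shift star_inv uT wT) subrr.
have Phi1k u w : k u \/ k w -> form Phi1 u w = 0.
  case=> [ku|kw]; apply: Phi1_0.
  - by apply: H2; auto.
  - by apply: H1.
  - by apply/sym/H1 => //; apply: Tdk.
  - by apply/sym/H2; auto.
have Phi1ef u w : e u -> f w -> form Phi1 u w = 0.
  by move=> eu fw; apply: Phi1_0; [apply: H9 | apply: H8] => //; auto.
have Phi1fe u w : f u -> e w -> form Phi1 u w = 0.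
  by move=> eu fw; apply: Phi1_0; [apply/sym/H8 | apply/sym/H9] => //; auto.
have Phi1cd u w : c u -> d w -> form Phi1 u w = 0.
  by move=> cu dw; apply: Phi1_0; [apply: H6 | apply/sym/H6'] => //; auto.
have Phi1dc u w : d u -> c w ->
    form Phi1 (u *m Td) (w *m Pc) + form Phi1 (u *m Pd) (w *m Tc)
    - form Phi1 (u *m Pd) (w *m Pc) = form Phi1 u w.
  move=> du cw.
  have -> : form Phi1 (u *m Td) (w *m Pc) = form Phi1 u (w *m Pc).
    apply: (mxform_shift star_inv); last by rewrite subrr (mxform0r star_inv).
    by rewrite Phi1E Tc0 // mxform0l subr0; apply: H6' => //; auto.
  have -> : form Phi1 (u *m Pd) (w *m Tc) = form Phi1 (u *m Pd) w.
    apply: (mxform_shift star_inv); first by rewrite subrr mxform0l.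
    by rewrite Phi1E Td0 // (mxform0r star_inv) subr0; apply/sym/H6 => //; auto.
  have : form Phi1 (u - u *m Pd) (w - w *m Pc) = 0.
    have [a ca ha] := Pdc _ du; have [b db hb] := Pcd _ cw.
    set u' := u - _ in ha *; set w' := w - _ in hb *.
    have uT : u' *m Tc = a *m Tc.
      by apply/eqP; rewrite -subr_eq0 -mulmxBl Tc0.
    have wT : w' *m Td = b *m Td.
      by apply/eqP; rewrite -subr_eq0 -mulmxBl Td0.
    apply/eqP; rewrite Phi1E subr_eq0; apply/eqP/esym/H10 => //.
    - by rewrite uT; apply: Tcc.
    - by apply: subspace_sub.
    - by apply: subspace_sub.
    - by rewrite wT; apply: Tdd.
    - by rewrite -opprB; apply: subspace_opp.
  rewrite mxformBl !(mxformBr star_inv) => /eqP; rewrite subr_eq0 subr_eq => /eqP ->.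
  by rewrite -addrA addrC.
pose Theta1 := Td *m Phi1 *m Pc^^star + Pd *m Phi1 *m Tc^^star - Pd *m Phi1 *m Pc^^star.
have Theta1E u w : form Theta1 u w = form Phi1 (u *m Td) (w *m Pc)
    + form Phi1 (u *m Pd) (w *m Tc) - form Phi1 (u *m Pd) (w *m Pc).
  by rewrite /Theta1 mxformB mxformD !(mxform_mul star_inv).
clearbody Theta1.
have eqPhi u w : form Theta1 u w = form Phi1 u w ->
    form (Tc *m Phi *m Td^^star + Theta1) u w = form Phi u w.
  by rewrite mxformD (mxform_mul star_inv) => ->; rewrite Phi1E addrC subrK.
exists (Tc *m Phi *m Td^^star + Theta1); split=> u w.
- rewrite mxformD (mxform_mul star_inv) Theta1E; case=> [hu|hw].
    by rewrite (Tc0 _ hu) (Td0 _ hu) (Pd0h _ hu) !mxform0l !(subr0, add0r).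
  by rewrite (Tc0 _ hw) (Td0 _ hw) (Pc0h _ hw) !(mxform0r star_inv) !(subr0, add0r).
- move=> kuw; apply: eqPhi; rewrite Theta1E [RHS]Phi1k //; case: kuw => [ku|kw].
    rewrite (Phi1k (u *m Td)); last by left; auto.
    by rewrite Pd0c ?mxform0l ?addr0 ?subr0; auto.
  rewrite (Phi1k _ (w *m Tc)); last by right; auto.
  by rewrite Pc0d ?(mxform0r star_inv) ?addr0 ?subr0; auto.
- move=> cu dw; apply: eqPhi; rewrite Theta1E Pc0d // Pd0c // !(mxform0l, mxform0r star_inv).
  by rewrite Phi1cd // !addr0 subr0.
- by move=> du cw; apply: eqPhi; rewrite Theta1E Phi1dc.
- case=> -[]; [move=> eu fw | move=> fu ew]; apply: eqPhi; rewrite Theta1E.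
    by rewrite Pd0c ?mxform0l ?addr0 ?subr0 ?Phi1ef //; auto.
  by rewrite Pc0d ?(mxform0r star_inv) ?add0r ?subr0 ?Phi1fe //; auto.
Qed.

Lemma mxform_glue n (M N : 'M[F]_n) (c d : 'rV[F]_n -> Prop) :
    subspace c -> subspace d ->
    (forall u w, c u -> d u -> c w -> d w -> form M u w = form N u w) ->
  exists X : 'M[F]_n, (forall u w, c u -> d w -> form X u w = form M u w) /\
                      (forall u w, d u -> c w -> form X u w = form N u w).
Proof.
move=> sc sd eqMN; pose W := N - M.
have [Pc [Pc0 Pcc Pcd]] := complement_proj divF sd sc.
have [Pd [Pd0 Pdd Pdc]] := complement_proj divF sc sd.
exists (M + (1%:M *m W *m Pc^^star + Pd *m W *m 1%:M^^star - Pd *m W *m Pc^^star)).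
split=> u w; rewrite mxformD mxformB mxformD !(mxform_mul star_inv) !mulmx1;
  [move=> cu dw | move=> du cw].
  by rewrite Pc0 // Pd0 // !(mxform0r star_inv, mxform0l) subr0 !addr0.
have : form W (u - u *m Pd) (w - w *m Pc) = 0.
  have du' := subspace_sub sd du (Pdd u); have cw' := subspace_sub sc cw (Pcc w).
  by rewrite mxformB eqMN ?subrr //; [apply: Pdc | apply: Pcd].
rewrite mxformBl !(mxformBr star_inv) => /eqP; rewrite subr_eq0 subr_eq => /eqP eqW.
suff -> : form N u w = form M u w + form W u w by rewrite eqW -addrA [X in _ + X]addrC.
by rewrite mxformB addrC subrK.
Qed.

(* The retractions [rc] and [rd] onto [b] differ on planes in which [b], [c] and
   [d] are three distinct lines: [rc] kills the line [d] and [rd] the line [c].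
   Using [rd] exactly for the blocks that involve the image of [P], a complement
   of [b :&: c :&: d] in [b :&: d], makes the form vanish on [c x d] and [d x c]. *)
Lemma mxform_extend n (Z : 'M[F]_n) (b c d : 'rV[F]_n -> Prop) :
    subspace b -> subspace c -> subspace d ->
    (forall u w, b u -> c u -> b w -> d w -> form Z u w = 0) ->
    (forall u w, b u -> d u -> b w -> c w -> form Z u w = 0) ->
    (forall u w x, b u -> c u -> d u -> b w -> c x -> d (w - x) ->
       form Z u w = 0 /\ form Z w u = 0) ->
  exists X : 'M[F]_n, [/\ forall u w, b u -> b w -> form X u w = form Z u w,
    forall u w, c u -> d w -> form X u w = 0 & forall u w, d u -> c w -> form X u w = 0].
Proof.
move=> sb sc sd Zcd Zdc Zef.
pose cd v := exists2 x, c x & d (v - x).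
have scd : subspace cd by apply: subspaceD.
have c_cd v : c v -> cd v by exists v => //; rewrite subrr; apply: subspace0.
have d_cd v : d v -> cd v by exists 0; rewrite ?subr0 //; apply: subspace0.
have Zef1 u w : b u -> c u -> d u -> b w -> cd w -> form Z u w = 0.
  by move=> bu cu du bw [x cx dwx]; have [] := Zef _ _ _ bu cu du bw cx dwx.
have Zfe u w : b u -> c u -> d u -> b w -> cd w -> form Z w u = 0.
  by move=> bu cu du bw [x cx dwx]; have [] := Zef _ _ _ bu cu du bw cx dwx.
have [r0 id0 _] := retraction_ex divF sb.
have [r1 [id1 r1cd _]] := retraction_refine divF sb scd id0.
have [rc [idc rcd /(_ _ scd d_cd r1cd) rccd]] := retraction_refine divF sb sd id1.
have [rd [idd rdc /(_ _ scd c_cd r1cd) rdcd]] := retraction_refine divF sb sc id1.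
have [P [Pc Pim Pd]] := complement_proj divF (subspaceI divF sb sc) (subspaceI divF sb sd).
pose Z1 := (1%:M - P) *m Z *m (1%:M - P)^^star.
have Z1E u w : form Z1 u w = form Z (u - u *m P) (w - w *m P).
  by rewrite /Z1 (mxform_mul star_inv) !mulmxBr !mulmx1.
clearbody Z1.
exists (rc *m Z1 *m rc^^star + rd *m (Z - Z1) *m rd^^star).
split=> u w; rewrite mxformD !(mxform_mul star_inv) mxformB !Z1E;
  [move=> bu bw | move=> cu dw | move=> du cw].
- by rewrite !(idc, idd) // addrC subrK.
- have [bu1 cdu1] := rccd _ (c_cd _ cu); have [bw1 dw1] := rcd _ dw.
  have [bP dP] := Pim (u *m rc); have [bQ dQ] := Pim (w *m rc).
  have [be ce] := Pd _ (conj bw1 dw1).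
  have bu' := subspace_sub sb bu1 bP.
  have cdu' := subspace_sub scd cdu1 (d_cd _ dP); have dw' := subspace_sub sd dw1 dQ.
  rewrite Zfe ?add0r //.
  have [bu2 cu2] := rdc _ cu; have [bw2 cdw2] := rdcd _ (d_cd _ dw).
  have [bR dR] := Pim (w *m rd).
  by rewrite (Pc (u *m rd)) // subr0 -(mxformBr star_inv) subKr; apply: Zcd.
- have [bw1 cdw1] := rccd _ (c_cd _ cw); have [bu1 du1] := rcd _ du.
  have [bP dP] := Pim (u *m rc); have [bQ dQ] := Pim (w *m rc).
  have [be ce] := Pd _ (conj bu1 du1).
  have bw' := subspace_sub sb bw1 bQ.
  have cdw' := subspace_sub scd cdw1 (d_cd _ dQ); have du' := subspace_sub sd du1 dP.
  rewrite Zef1 ?add0r //.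
  have [bw2 cw2] := rdc _ cw; have [bu2 cdu2] := rdcd _ (d_cd _ du).
  have [bR dR] := Pim (u *m rd).
  by rewrite (Pc (w *m rd)) // subr0 -mxformBl subKr; apply: Zdc.
Qed.

End Forms.

Section System.

Context (F : unitRingType) (divF : GRing.field_axiom F) (star : F -> F).
Hypothesis star_inv : involutive_antiautomorphism star.
Hypothesis charF : 2%N \notin [pchar F].

Local Notation form := (mxform star).

Let two_unit : (2%:R : F) \is a GRing.unit.
Proof. by apply: divF; apply: contra charF => /eqP e2; rewrite inE /= e2. Qed.

Lemma mxform_lift m n p q (N : 'M[F]_(m, n)) (A : 'M_(m, p)) (B : 'M_(n, q)) :
    (forall u w, u *m A = 0 -> form N u w = 0) ->
    (forall u w, w *m B = 0 -> form N u w = 0) ->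
  exists M : 'M_(p, q), forall u w, form M (u *m A) (w *m B) = form N u w.
Proof.
move=> NA NB; exists (pinv A *m N *m (pinv B)^^star) => u w.
rewrite (mxform_mul star_inv) -!mulmxA; apply: (mxform_shift star_inv) => //.
  by apply: NA; rewrite -{1}[u]mulmx1 -mulmxBr -mulmxA lker_pinv // mulmx0.
by apply: NB; rewrite -{1}[w]mulmx1 -mulmxBr -mulmxA lker_pinv // mulmx0.
Qed.

Lemma hermitian_part n (X : 'M[F]_n) : exists2 H, is_hermitian star H &
  forall u w, form H u w *+ 2 = form X u w + (form X w u)^^star.
Proof.
pose half : F := 2%:R^-1.
have halfC x : x * half = half * x by apply/commrV/commr_nat.
have star2 : star 2%:R = 2%:R.
  by case: star_inv => starD _ _; rewrite mulr2n starD star1.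
have star_half : star half = half.
  case: star_inv => _ starM _; apply: (mulIr two_unit).
  by rewrite mulVr // -{1}star2 -starM divrr // star1.
pose H := half *: (X + X^^star).
have H2 : H *+ 2 = X + X^^star.
  by rewrite /H -scaler_nat scalerA divrr // scale1r.
exists H.
  rewrite /is_hermitian; apply/matrixP => i j; rewrite !mxE.
  case: star_inv => starD starM starK.
  by rewrite starM starD starK star_half halfC addrC.
by move=> u w; rewrite -(mxform_conj star_inv) -mxformD -H2 mulr2n mxformD.
Qed.

Lemma mx_double_inj m n (M N : 'M[F]_(m, n)) : M *+ 2 = N *+ 2 -> M = N.
Proof.
rewrite -!scaler_nat => /(congr1 (GRing.scale 2%:R^-1)).
by rewrite !scalerA mulVr // !scale1r.
Qed.

(* The ten conditions are, in order, the ten rank equalities of the theorem, with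
   [D'] standing for [D^*]. *)
Definition kernel_conditions m p q s t (A : 'M[F]_(m, p)) (B : 'M[F]_(m, q))
    (C : 'M[F]_(s, p)) (D' : 'M[F]_(t, p)) (Phi : 'M[F]_m) (Omega : 'M[F]_(s, t)) :=
  (forall u w, u *m A = 0 -> w *m B = 0 -> form Phi u w = 0) /\
  (forall u w, u *m A = 0 -> u *m B = 0 -> form Phi u w = 0) /\
  (forall x y, x *m C = 0 -> form Omega x y = 0) /\
  (forall x y, y *m D' = 0 -> form Omega x y = 0) /\
  (forall x y x' y', x *m C = y *m D' -> x' *m C = y' *m D' ->
     form Omega x y' = form (Omega^^star) y x') /\
  (forall u x w y, u *m A = x *m C -> u *m B = 0 -> w *m A = y *m D' ->
     form Phi u w = form Omega x y) /\
  (forall u x w y, u *m A = x *m C -> w *m A = y *m D' -> w *m B = 0 ->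
     form Phi u w = form Omega x y) /\
  (forall u x y w x' y', u *m A = x *m C -> u *m A = y *m D' ->
     w *m A = y' *m D' + x' *m C -> w *m B = 0 ->
     form Phi u w = form Omega x y' + form (Omega^^star) y x') /\
  (forall u x y w x' y', u *m A = x *m C -> u *m A = y *m D' -> u *m B = 0 ->
     w *m A = y' *m D' + x' *m C ->
     form Phi u w = form Omega x y' + form (Omega^^star) y x') /\
  (forall u v x y u' v' x' y',
     u *m A = x *m C -> v *m A = y *m D' -> u *m B = v *m B ->
     u' *m A = x' *m C -> v' *m A = y' *m D' -> u' *m B = v' *m B ->
     form Phi u v' - form Phi v u' = form Omega x y' - form (Omega^^star) y x').

Lemma kernel_conditions_solution m p q s t (A : 'M[F]_(m, p)) (B : 'M[F]_(m, q))
    (C : 'M[F]_(s, p)) (D' : 'M[F]_(t, p)) (Phi : 'M[F]_m) (Omega : 'M[F]_(s, t)) :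
    is_hermitian star Phi -> kernel_conditions A B C D' Phi Omega ->
  exists (X : 'M[F]_p) (Y : 'M[F]_q),
   [/\ is_hermitian star X, is_hermitian star Y,
       forall u w, form X (u *m A) (w *m A) + form Y (u *m B) (w *m B) = form Phi u w
     & forall x y, form X (x *m C) (y *m D') = form Omega x y].
Proof.
move=> hPhi [K1 [K2 [K3 [K4 [K5 [K6 [K7 [K8 [K9 K10]]]]]]]]].
have conj0 : (0 : 'M[F]_1)^^star = 0 by rewrite (conjtrmx0 star_inv).
have [M1 M1E] := mxform_lift K3 K4.
have [M2 M2E] : exists M2 : 'M_p, forall u w,
    form M2 (u *m D') (w *m C) = form (Omega^^star) u w.
  by apply: mxform_lift => u w e0; rewrite (mxform_conj star_inv); [rewrite K4 | rewrite K3].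
have sc := subspace_row C; have sd := subspace_row D'; have sb := subspace_row A.
have [X1 [X1cd X1dc]] : exists X : 'M[F]_p,
    (forall u w, left_row_space C u -> left_row_space D' w -> form X u w = form M1 u w) /\
    (forall u w, left_row_space D' u -> left_row_space C w -> form X u w = form M2 u w).
  apply: mxform_glue => // u w [x ux] [y uy] [x' wx] [y' wy].
  by rewrite {1}ux {1}wy uy wx M1E M2E; apply: K5; rewrite -?ux -?uy -?wx -?wy.
have {X1cd X1dc M1 M1E M2 M2E} [X0 hX0 [X0cd X0dc]] : exists2 X0 : 'M[F]_p,
    is_hermitian star X0 &
    (forall x y, form X0 (x *m C) (y *m D') = form Omega x y) /\
    (forall x y, form X0 (y *m D') (x *m C) = form (Omega^^star) y x).
  have X1cd' x y : form X1 (x *m C) (y *m D') = form Omega x y.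
    by rewrite X1cd ?M1E //; [exists x | exists y].
  have X1dc' x y : form X1 (y *m D') (x *m C) = form (Omega^^star) y x.
    by rewrite X1dc ?M2E //; [exists y | exists x].
  have [X0 hX0 X0E] := hermitian_part X1.
  exists X0 => //; split=> x y; apply: mx_double_inj; rewrite X0E X1cd' X1dc'.
    by rewrite -(mxform_conj star_inv) conjtrmxK // mulr2n.
  by rewrite -(mxform_conj star_inv) mulr2n.
pose Phi' := Phi - A *m X0 *m A^^star.
have Phi'E u w : form Phi' u w = form Phi u w - form X0 (u *m A) (w *m A).
  by rewrite mxformB (mxform_mul star_inv).
have hPhi' : is_hermitian star Phi'.
  by rewrite /is_hermitian /Phi' conjtrmxB // !conjtrmxM // conjtrmxK // -hX0 -hPhi mulmxA.
clearbody Phi'.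
have sym u w : form Phi' w u = 0 -> form Phi' u w = 0.
  by rewrite (mxform_hermitian star_inv u w hPhi') => ->.
pose h (v : 'rV_m) := v *m B = 0; pose k (v : 'rV_m) := v *m A = 0.
pose c v := left_row_space C (v *m A); pose d v := left_row_space D' (v *m A).
pose e v := c v /\ d v.
pose f v := exists2 x, left_row_space C x & left_row_space D' (v *m A - x).
have sh : subspace h by apply: subspace_ker.
have sk : subspace k by apply: subspace_ker.
have sc' : subspace c by apply: subspace_preim.
have sd' : subspace d by apply: subspace_preim.
have se : subspace e by apply: subspaceI.
have sf : subspace f by apply: (subspace_preim divF A (subspaceD sc sd)).
have [||||||||||||Theta [Th0 Thk Thcd Thdc Thef]] :=
  mxform_descend divF star_inv (Phi := Phi') hPhi' sh sk se sc' sd' sf.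
- by move=> v kv; split; rewrite /c /d kv; apply: subspace0.
- by move=> v [].
- by move=> v [].
- by move=> v cv; exists (v *m A) => //; rewrite subrr; apply: subspace0.
- by move=> v dv; exists 0; rewrite ?subr0 //; apply: subspace0.
- by move=> u w ku hw; rewrite Phi'E K1 // ku mxform0l subrr.
- by move=> u w ku hu; rewrite Phi'E K2 // ku mxform0l subrr.
- move=> u w hu [x ux] [y wy].
  by rewrite Phi'E (K6 _ _ _ _ ux hu wy) ux wy X0cd subrr.
- move=> u w hu [y uy] [x wx]; apply: sym.
  by rewrite Phi'E (K7 _ _ _ _ wx uy hu) uy wx X0cd subrr.
- move=> u w [[x ux] [y uy]] [_ [x' ->] [y' wxy]] hw.
  have wA : w *m A = y' *m D' + x' *m C by rewrite -wxy subrK.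
  rewrite Phi'E (K8 _ _ _ _ _ _ ux uy wA hw) wA (mxformDr star_inv).
  by rewrite {1}ux uy X0cd X0dc subrr.
- move=> u w [[x ux] [y uy]] hu [_ [x' ->] [y' wxy]].
  have wA : w *m A = y' *m D' + x' *m C by rewrite -wxy subrK.
  rewrite Phi'E (K9 _ _ _ _ _ _ ux uy hu wA) wA (mxformDr star_inv).
  by rewrite {1}ux uy X0cd X0dc subrr.
- move=> u v u' v' [x ux] [y vy] huv [x' ux'] [y' vy'] huv'.
  have eB : u *m B = v *m B by apply/esym/eqP; rewrite -subr_eq0 -mulmxBl huv.
  have eB' : u' *m B = v' *m B by apply/esym/eqP; rewrite -subr_eq0 -mulmxBl huv'.
  rewrite !Phi'E; have := K10 _ _ _ _ _ _ _ _ ux vy eB ux' vy' eB'.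
  rewrite ux vy ux' vy' X0cd X0dc => /eqP; rewrite subr_eq => /eqP ->.
  by rewrite -addrA addrC addrA subrK.
have [Y YE] : exists Y : 'M_q, forall u w, form Y (u *m B) (w *m B) = form Theta u w.
  by apply: mxform_lift => u w e0; apply: Th0; [left | right].
have [Z ZE] : exists Z : 'M_p, forall u w,
    form Z (u *m A) (w *m A) = form (Phi' - Theta) u w.
  by apply: mxform_lift => u w e0; rewrite mxformB Thk ?subrr //; [left | right].
have [|||X' [X'b X'cd X'dc]] := mxform_extend divF star_inv (Z := Z) sb sc sd.
- by move=> _ _ [u ->] cu [w ->] dw; rewrite ZE mxformB Thcd ?subrr.
- by move=> _ _ [u ->] cu [w ->] dw; rewrite ZE mxformB Thdc ?subrr.
- move=> _ _ x [u ->] cu du [w ->] cx dwx.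
  have eu : e u by []; have fw : f w by exists x.
  by rewrite !ZE !mxformB !Thef ?subrr; auto.
have [X hX XE] := hermitian_part (X0 + X'); have [Y1 hY1 Y1E] := hermitian_part Y.
have solve u w : form (X0 + X') (u *m A) (w *m A) + form Y (u *m B) (w *m B) = form Phi u w.
  rewrite mxformD X'b; [|by exists u|by exists w].
  by rewrite ZE YE mxformB -addrA subrK Phi'E addrC subrK.
exists X, Y1; split=> // [u w | x y]; apply: mx_double_inj.
  rewrite mulrnDl XE Y1E addrACA solve -conjtrmxD // solve.
  by rewrite -(mxform_hermitian star_inv _ _ hPhi) mulr2n.
rewrite XE !mxformD X0cd X0dc X'cd ?X'dc; try by [exists x | exists y].
by rewrite !addr0 (mxform_conj star_inv) conjtrmxK // mulr2n.
Qed.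

Lemma solution_kernel_conditions m p q s t (A : 'M[F]_(m, p)) (B : 'M[F]_(m, q))
    (C : 'M[F]_(s, p)) (D' : 'M[F]_(t, p)) (Phi : 'M[F]_m) (Omega : 'M[F]_(s, t))
    (X : 'M[F]_p) (Y : 'M[F]_q) :
    is_hermitian star X ->
    (forall u w, form X (u *m A) (w *m A) + form Y (u *m B) (w *m B)
                 = form Phi u w) ->
    (forall x y, form X (x *m C) (y *m D') = form Omega x y) ->
  kernel_conditions A B C D' Phi Omega.
Proof.
move=> hX PhiE OmE.
have OmE' x y : form X (y *m D') (x *m C) = form (Omega^^star) y x.
  by rewrite (mxform_conj star_inv) -OmE -(mxform_hermitian star_inv).
pose f0l := @mxform0l _ star; pose f0r := mxform0r star_inv.
rewrite /kernel_conditions; do 9?split.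
- by move=> u w uA wB; rewrite -PhiE uA wB f0l f0r addr0.
- by move=> u w uA uB; rewrite -PhiE uA uB !f0l addr0.
- by move=> x y xC; rewrite -OmE xC f0l.
- by move=> x y yD; rewrite -OmE yD f0r.
- by move=> x y x' y' e1 e2; rewrite -OmE -OmE' e1 e2.
- by move=> u x w y uA uB wA; rewrite -PhiE uA uB wA f0l addr0 OmE.
- by move=> u x w y uA wA wB; rewrite -PhiE uA wA wB f0r addr0 OmE.
- move=> u x y w x' y' e1 e2 wA wB; rewrite -PhiE wA wB f0r addr0 (mxformDr star_inv).
  by rewrite {1}e1 e2 OmE OmE'.
- move=> u x y w x' y' e1 e2 uB wA; rewrite -PhiE wA uB f0l addr0 (mxformDr star_inv).
  by rewrite {1}e1 e2 OmE OmE'.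
- move=> u v x y u' v' x' y' uA vA uB uA' vA' uB'.
  by rewrite -!PhiE uA vA uB uA' vA' uB' OmE OmE' opprD addrACA subrr addr0.
Qed.

End System.

Section RankRegrouping.

Context (F : unitRingType) (divF : GRing.field_axiom F) (star : F -> F).
Hypothesis star_inv : involutive_antiautomorphism star.
Local Notation form := (mxform star).

Lemma left_rank_castmx m n m' n' (e : (m = m') * (n = n')) (M : 'M[F]_(m, n)) :
  left_rank (castmx e M) = left_rank M.
Proof. by case: e => e1 e2; case: _ / e1; case: _ / e2; rewrite castmx_id. Qed.

(* Right multiplication by [assocmx] regroups columns simultaneously in all rows. *)
Definition assocmx n1 n2 n3 : 'M[F]_(n1 + (n2 + n3), n1 + n2 + n3) :=
  castmx (erefl, addnA n1 n2 n3) 1%:M.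

Lemma mulmx_castmx1 m n k (e : n = k) (M : 'M[F]_(m, n)) :
  M *m castmx (erefl, e) 1%:M = castmx (erefl, e) M.
Proof. by case: _ / e; rewrite !castmx_id mulmx1. Qed.

Lemma left_rank_assoc m n1 n2 n3 (M : 'M[F]_(m, n1 + (n2 + n3))) :
  left_rank (M *m assocmx n1 n2 n3) = left_rank M.
Proof. by rewrite mulmx_castmx1 left_rank_castmx. Qed.

Lemma row_assocmx m n1 n2 n3 (M1 : 'M[F]_(m, n1)) (M2 : 'M[F]_(m, n2))
    (M3 : 'M[F]_(m, n3)) :
  (M1 <|> M2 <|> M3) *m assocmx n1 n2 n3 = (M1 <|> M2) <|> M3.
Proof.
rewrite /assocmx mulmx_castmx1 row_mxA castmx_comp.
by apply: castmx_id.
Qed.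

Lemma left_rank_rowA m n1 n2 n3 (M1 : 'M[F]_(m, n1)) (M2 : 'M[F]_(m, n2))
    (M3 : 'M[F]_(m, n3)) :
  left_rank (M1 <|> M2 <|> M3) = left_rank ((M1 <|> M2) <|> M3).
Proof. by rewrite -left_rank_assoc row_assocmx. Qed.

Lemma left_rank_colA m1 m2 m3 n (M1 : 'M[F]_(m1, n)) (M2 : 'M[F]_(m2, n))
    (M3 : 'M[F]_(m3, n)) :
  left_rank (M1 </> M2 </> M3) = left_rank ((M1 </> M2) </> M3).
Proof. by rewrite col_mxA left_rank_castmx. Qed.

Lemma left_rank_rowC m n1 n2 (M1 : 'M[F]_(m, n1)) (M2 : 'M[F]_(m, n2)) :
  left_rank (M1 <|> M2) = left_rank (M2 <|> M1).
Proof.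
pose J a b : 'M[F]_(a + b, b + a) := block_mx 0 1%:M 1%:M 0.
have JJ : J n1 n2 *m J n2 n1 = 1%:M.
  rewrite mulmx_block !(mulmx0, mul0mx, addr0, add0r) !mulmx1.
  by rewrite -scalar_mx_block.
rewrite -(left_rank_mul_rinv divF _ JJ) mul_row_block.
by rewrite !(mulmx0, mul0mx, addr0, add0r) !mulmx1.
Qed.

Lemma left_rank_colC m1 m2 n (M1 : 'M[F]_(m1, n)) (M2 : 'M[F]_(m2, n)) :
  left_rank (M1 </> M2) = left_rank (M2 </> M1).
Proof.
suff le k l (N1 : 'M[F]_(k, n)) (N2 : 'M_(l, n)) :
    (left_rank (N1 </> N2) <= left_rank (N2 </> N1))%N by apply/eqP; rewrite eqn_leq !le.
have -> : N1 </> N2 = block_mx 0 1%:M 1%:M 0 *m (N2 </> N1).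
  by rewrite mul_block_col !mul0mx !mul1mx add0r addr0.
exact: left_rank_mull.
Qed.

Lemma left_rank_colAC m1 m2 m3 n (M1 : 'M[F]_(m1, n)) (M2 : 'M[F]_(m2, n))
    (M3 : 'M[F]_(m3, n)) :
  left_rank (M1 </> M2 </> M3) = left_rank (M1 </> M3 </> M2).
Proof.
suff le k l (N2 : 'M[F]_(k, n)) (N3 : 'M_(l, n)) :
    (left_rank (M1 </> N2 </> N3) <= left_rank (M1 </> N3 </> N2))%N.
  by apply/eqP; rewrite eqn_leq !le.
have -> : M1 </> N2 </> N3 = block_mx 1%:M 0 0 (block_mx 0 1%:M 1%:M 0)
                              *m (M1 </> N3 </> N2).
  by rewrite !mul_block_col !mul0mx !mul1mx !add0r !addr0.
exact: left_rank_mull.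
Qed.

Lemma left_rank_block_swap m1 m2 n1 n2 (M1 : 'M[F]_(m1, n1)) (M2 : 'M[F]_(m1, n2))
    (M3 : 'M[F]_(m2, n1)) (M4 : 'M[F]_(m2, n2)) :
  left_rank (block_mx M1 M2 M3 M4) = left_rank (block_mx M4 M3 M2 M1).
Proof.
by rewrite block_mxEv left_rank_colC -block_mxEv block_mxEh left_rank_rowC -block_mxEh.
Qed.

Lemma left_rank0 m n : left_rank (0 : 'M[F]_(m, n)) = 0%N.
Proof.
by apply: (factor_left_rank divF (P := 0) (Q := 0) (S := 0) (T := 0));
  rewrite ?mulmx0 //; apply/matrixP=> -[].
Qed.

Lemma left_rank_row0 m k n (M : 'M[F]_(m, n)) :
  left_rank ((0 : 'M_(m, k)) <|> M) = left_rank M.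
Proof.
have JJ : (row_mx (0 : 'M[F]_(n, k)) 1%:M) *m col_mx 0 1%:M = 1%:M.
  by rewrite mul_row_col mulmx0 mulmx1 add0r.
by rewrite -(left_rank_mul_rinv divF M JJ) mul_mx_row mulmx0 mulmx1.
Qed.

Lemma left_rank_col0 k m n (M : 'M[F]_(m, n)) :
  left_rank ((0 : 'M_(k, n)) </> M) = left_rank M.
Proof.
apply/eqP; rewrite eqn_leq; apply/andP; split; last first.
  have {1}-> : M = (0 <|> 1%:M) *m ((0 : 'M_(k, n)) </> M).
    by rewrite mul_row_col mul0mx mul1mx add0r.
  exact: left_rank_mull.
have -> : (0 : 'M_(k, n)) </> M = (0 </> 1%:M) *m M by rewrite mul_col_mx mul0mx mul1mx.
exact: left_rank_mull.
Qed.

Lemma left_rank_rowP m n1 n2 (L : 'M[F]_(m, n1)) (E : 'M[F]_(m, n2)) :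
  left_rank (L <|> E) = left_rank L <->
  forall x w, x *m L = 0 -> form E x w = 0.
Proof.
have := left_rank_blockP divF star_inv (0 : 'M_(1, n2)) L E.
rewrite block_mxEv row_mx0 left_rank_col0 left_rank0 addn0 => ->.
by split=> H x w xL;
  [apply: H => //; rewrite (conjtrmx0 star_inv) mulmx0 | move=> _; apply: H].
Qed.

Lemma left_rank_colP m1 m2 n (R : 'M[F]_(m1, n)) (E : 'M[F]_(m2, n)) :
  left_rank (R </> E) = left_rank R <->
  forall x w, w *m R^^star = 0 -> form E x w = 0.
Proof.
have := left_rank_blockP divF star_inv R (0 : 'M_(m2, 1)) E.
rewrite block_mxEh col_mx0 left_rank_row0 left_rank0 add0n => ->.
by split=> H x w; [move=> wR; apply: H => //; rewrite mulmx0 | move=> _; apply: H].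
Qed.

End RankRegrouping.

Section RankConditions.

Context (F : unitRingType) (divF : GRing.field_axiom F) (star : F -> F).
Hypothesis star_inv : involutive_antiautomorphism star.
Local Notation form := (mxform star).

Lemma left_rank_blockPC m1 m2 n1 n2 (R : 'M[F]_(m1, n2)) (L : 'M[F]_(m2, n1)) E :
  left_rank (block_mx 0 R L E) = (left_rank R + left_rank L)%N <->
  forall x w, x *m L = 0 -> w *m R^^star = 0 -> form E x w = 0.
Proof. by rewrite [(left_rank R + _)%N]addnC; apply: left_rank_blockP. Qed.

(* The minus signs turn the equations [x *m L = 0] into the equalities used in
   [kernel_conditions]. *)
Lemma row_split2 n1 n2 (v : 'rV[F]_(n1 + n2)) : exists x y, v = x <|> - y.
Proof. by exists (lsubmx v), (- rsubmx v); rewrite opprK hsubmxK. Qed.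

Lemma row_split3 n1 n2 n3 (v : 'rV[F]_(n1 + (n2 + n3))) :
  exists x y z, v = x <|> - y <|> - z.
Proof.
have [x [y ->]] := row_split2 v; have [y1 [y2 ->]] := row_split2 y.
by exists x, y1, (- y2); rewrite opp_row_mx.
Qed.

Lemma row_split4 n1 n2 n3 (v : 'rV[F]_(n1 + (n2 + (n3 + n3)))) :
  exists x y z1 z2, v = - x <|> - y <|> z1 <|> z2 - z1.
Proof.
exists (- lsubmx v), (- lsubmx (rsubmx v)), (lsubmx (rsubmx (rsubmx v))).
exists (rsubmx (rsubmx (rsubmx v)) + lsubmx (rsubmx (rsubmx v))).
by rewrite !opprK addrK !hsubmxK.
Qed.

Local Notation mulE := (mul_mx_row, mul_row_col, add_row_mx, mulNmx, mulmxN, opprK,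
  mulmx0, mul0mx, oppr0, addr0, add0r).
Local Notation formE := (mxform_col, mxform_row, mxform0, mxformNl,
  (mxformNr star_inv), mxformN, opprK, oppr0, addr0, add0r).

Context (m p q s t : nat).
Context (A : 'M[F]_(m, p)) (B : 'M[F]_(m, q)) (C : 'M[F]_(s, p)) (D : 'M[F]_(p, t)).
Context (Phi : 'M[F]_m) (Omega : 'M[F]_(s, t)).

Lemma rank_condition1 :
  (left_rank (Phi     <|> A </>
              B^^star <|> 0)
     = left_rank A + left_rank B)%N <->
  (forall u w, u *m A = 0 -> w *m B = 0 -> form Phi u w = 0).
Proof.
rewrite -block_mxEv (left_rank_block_swap divF).
rewrite -[left_rank B](left_rank_conjtrmx divF star_inv).
by rewrite (left_rank_blockP divF star_inv) conjtrmxK.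
Qed.

Lemma rank_condition2 :
  left_rank (A <|> B <|> Phi) = left_rank (A <|> B) <->
  (forall u w, u *m A = 0 -> u *m B = 0 -> form Phi u w = 0).
Proof.
rewrite left_rank_rowA // (left_rank_rowP divF star_inv).
split=> H u w; first by move=> uA uB; apply: H; rewrite mul_mx_row uA uB row_mx0.
by rewrite mul_mx_row -(row_mx0 F 1 p q) => /eq_row_mx[]; apply: H.
Qed.

Lemma rank_condition5 :
  (left_rank (Omega <|> 0              <|> C       </>
              0     <|> - Omega^^star  <|> D^^star </>
              D     <|> C^^star        <|> 0)
     = 2 * left_rank (C </>
                      D^^star))%N <->
  (forall x y x' y', x *m C = y *m D^^star -> x' *m C = y' *m D^^star ->
     form Omega x y' = form (Omega^^star) y x').
Proof.
rewrite -left_rank_assoc !mul_col_mx !row_assocmx left_rank_colA //.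
rewrite rows2 -block_mxEv (left_rank_block_swap divF) mul2n -addnn.
have rankR : left_rank (D <|> C^^star) = left_rank (C </> D^^star).
  rewrite -(left_rank_conjtrmx divF star_inv) conjtrmx_row conjtrmxK //.
  exact: left_rank_colC.
rewrite -{2}rankR.
rewrite (left_rank_blockP divF star_inv) conjtrmx_row conjtrmxK //.
split=> [H x y x' y' e e'|H x w].
  apply/eqP; rewrite -subr_eq0; apply/eqP.
  have := H (x <|> - y) (y' <|> - x'); rewrite !mulE e e' !subrr.
  by move=> /(_ erefl erefl); rewrite !formE.
have [x1 [y1 ->]] := row_split2 x; have [w1 [z1 ->]] := row_split2 w.
rewrite !mulE !formE => /eqP; rewrite subr_eq0 => /eqP e /eqP.
by rewrite subr_eq0 eq_sym => /eqP e'; rewrite (H _ _ _ _ e e') subrr.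
Qed.

Lemma rank_condition6 :
  (left_rank (0 <|> 0 <|> A^^star <|> D </>
              A <|> B <|> - Phi   <|> 0 </>
              C <|> 0 <|> 0       <|> Omega)
     = left_rank (A <|> B </>
                  C <|> 0)
       + left_rank (A^^star <|> D))%N <->
  (forall u x w y, u *m A = x *m C -> u *m B = 0 -> w *m A = y *m D^^star ->
     form Phi u w = form Omega x y).
Proof.
rewrite -left_rank_assoc !mul_col_mx !row_assocmx (rows2 (A <|> B)) row_mx0 -(block_mxEv 0).
rewrite (left_rank_blockP divF star_inv) conjtrmx_row conjtrmxK //.
split=> [H u x w y uA uB wA | H x w].
  apply/eqP; rewrite eq_sym -subr_eq0 addrC; apply/eqP.
  have := H (u <|> - x) (w <|> - y); rewrite !mulE uA uB wA !subrr row_mx0.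
  by move=> /(_ erefl erefl); rewrite !formE.
have [u [x1 ->]] := row_split2 x; have [w1 [y1 ->]] := row_split2 w.
rewrite !mulE !formE -(row_mx0 F 1 p q) => /eq_row_mx[/eqP].
rewrite subr_eq0 => /eqP uA uB /eqP; rewrite subr_eq0 => /eqP wA.
by rewrite (H _ _ _ _ uA uB wA) addNr.
Qed.

Lemma rank_condition7 :
  (left_rank (0 <|> A^^star <|> D </>
              0 <|> B^^star <|> 0 </>
              A <|> - Phi   <|> 0 </>
              C <|> 0       <|> Omega)
     = left_rank (A^^star <|> D </>
                  B^^star <|> 0)
       + left_rank (A </>
                    C))%N <->
  (forall u x w y, u *m A = x *m C -> w *m A = y *m D^^star -> w *m B = 0 ->
     form Phi u w = form Omega x y).
Proof.
rewrite left_rank_colA (rows2 0) (rows2 A) col_mx0 -(block_mxEv 0).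
rewrite left_rank_blockPC conjtrmx_col !conjtrmx_row !conjtrmxK // conjtrmx0 //.
split=> [H u x w y uA wA wB | H x w].
  apply/eqP; rewrite eq_sym -subr_eq0 addrC; apply/eqP.
  have := H (u <|> - x) (w <|> - y); rewrite !mulE uA wA wB !subrr row_mx0.
  by move=> /(_ erefl erefl); rewrite !formE.
have [u [x1 ->]] := row_split2 x; have [w1 [y1 ->]] := row_split2 w.
rewrite !mulE !formE => /eqP; rewrite subr_eq0 => /eqP uA.
rewrite -(row_mx0 F 1 p q) => /eq_row_mx[/eqP]; rewrite subr_eq0 => /eqP wA wB.
by rewrite (H _ _ _ _ uA wA wB) addNr.
Qed.

Lemma rank_condition8 :
  (left_rank (0 <|> 0       <|> A^^star <|> D     <|> C^^star </>
              0 <|> 0       <|> B^^star <|> 0     <|> 0       </>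
              A <|> A       <|> - Phi   <|> 0     <|> 0       </>
              C <|> 0       <|> 0       <|> Omega <|> 0       </>
              0 <|> D^^star <|> 0       <|> 0     <|> Omega^^star)
     = left_rank (A       <|> B </>
                  C       <|> 0 </>
                  D^^star <|> 0)
       + left_rank (A <|> A </>
                    C <|> 0 </>
                    0 <|> D^^star))%N <->
  (forall u x y w x' y', u *m A = x *m C -> u *m A = y *m D^^star ->
     w *m A = y' *m D^^star + x' *m C -> w *m B = 0 ->
     form Phi u w = form Omega x y' + form (Omega^^star) y x').
Proof.
rewrite -left_rank_assoc !mul_col_mx !row_assocmx.
rewrite [left_rank (_ </> _ </> _ </> _)]left_rank_colA.
rewrite (rows2 (0 <|> 0)) (rows3 (A <|> A)) (row_mx0 _ p p p) (row_mx0 _ q p p).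
rewrite col_mx0 -(block_mxEv 0).
have -> : left_rank (A <|> B </> C <|> 0 </> D^^star <|> 0)
          = left_rank (A^^star <|> D <|> C^^star </> B^^star <|> 0 <|> 0).
  rewrite -[RHS](left_rank_conjtrmx divF star_inv) conjtrmx_col !conjtrmx_row.
  by rewrite !conjtrmxK // !conjtrmx0 // -rows3 (left_rank_colAC divF).
rewrite left_rank_blockPC conjtrmx_col !conjtrmx_row !conjtrmxK // !conjtrmx0 //.
split=> [H u x y w x' y' ux uy wA wB | H x w].
  apply/eqP; rewrite eq_sym -subr_eq0 addrC; apply/eqP.
  have := H (u <|> - x <|> - y) (w <|> - y' <|> - x'); rewrite !mulE.
  rewrite {1}ux uy wA wB !subrr -opprD subrr !(row_mx0 F 1).
  by move=> /(_ erefl erefl); rewrite !formE.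
have [u [x1 [y1 ->]]] := row_split3 x; have [w1 [z1 [z2 ->]]] := row_split3 w.
rewrite !mulE !formE -(row_mx0 F 1 p p) => /eq_row_mx[/eqP].
rewrite subr_eq0 => /eqP ux /eqP; rewrite subr_eq0 => /eqP uy.
rewrite -(row_mx0 F 1 p q) => /eq_row_mx[/eqP]; rewrite -opprD subr_eq0 => /eqP wA wB.
by rewrite (H _ _ _ _ _ _ ux uy wA wB) addNr.
Qed.

Lemma rank_condition9 :
  (left_rank (0 <|> 0       <|> 0 <|> A^^star <|> D     <|> C^^star </>
              A <|> A       <|> B <|> - Phi   <|> 0     <|> 0       </>
              C <|> 0       <|> 0 <|> 0       <|> Omega <|> 0       </>
              0 <|> D^^star <|> 0 <|> 0       <|> 0     <|> Omega^^star)
     = left_rank (A </>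
                  C </>
                  D^^star)
       + left_rank (A <|> A       <|> B </>
                    C <|> 0       <|> 0 </>
                    0 <|> D^^star <|> 0))%N <->
  (forall u x y w x' y', u *m A = x *m C -> u *m A = y *m D^^star -> u *m B = 0 ->
     w *m A = y' *m D^^star + x' *m C ->
     form Phi u w = form Omega x y' + form (Omega^^star) y x').
Proof.
have -> : left_rank (A <|> A <|> B </> C <|> 0 <|> 0 </> 0 <|> D^^star <|> 0)
          = left_rank ((A <|> A) <|> B </> (C <|> 0) <|> 0 </> (0 <|> D^^star) <|> 0).
  by rewrite -left_rank_assoc !mul_col_mx !row_assocmx.
have -> : left_rank (A </> C </> D^^star) = left_rank (A^^star <|> D <|> C^^star).
  rewrite -[RHS](left_rank_conjtrmx divF star_inv) !conjtrmx_row.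
  by rewrite !conjtrmxK // (left_rank_colAC divF).
rewrite -left_rank_assoc !mul_col_mx !row_assocmx.
rewrite -left_rank_assoc !mul_col_mx !row_assocmx.
rewrite (rows3 ((A <|> A) <|> B)) (row_mx0 _ p p p) (row_mx0 _ p (p + p) q) -(block_mxEv 0).
rewrite left_rank_blockPC !conjtrmx_row !conjtrmxK //.
split=> [H u x y w x' y' ux uy uB wA | H x w].
  apply/eqP; rewrite eq_sym -subr_eq0 addrC; apply/eqP.
  have := H (u <|> - x <|> - y) (w <|> - y' <|> - x'); rewrite !mulE.
  rewrite {1}ux uy uB wA !subrr -opprD subrr !(row_mx0 F 1).
  by move=> /(_ erefl erefl); rewrite !formE.
have [u [x1 [y1 ->]]] := row_split3 x; have [w1 [z1 [z2 ->]]] := row_split3 w.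
rewrite !mulE !formE -(row_mx0 F 1 (p + p) q) -(row_mx0 F 1 p p).
move=> /eq_row_mx[/eq_row_mx[/eqP]].
rewrite subr_eq0 => /eqP ux /eqP; rewrite subr_eq0 => /eqP uy uB /eqP.
rewrite -opprD subr_eq0 => /eqP wA.
by rewrite (H _ _ _ _ _ _ ux uy uB wA) addNr.
Qed.

Lemma rank_condition10 :
  (left_rank
     (0 <|> 0 <|> 0       <|> 0           <|> 0       <|> 0       <|> B^^star </>
      0 <|> 0 <|> 0       <|> C^^star     <|> 0       <|> A^^star <|> 0       </>
      0 <|> 0 <|> 0       <|> 0           <|> D       <|> A^^star <|> A^^star </>
      0 <|> C <|> 0       <|> 0           <|> - Omega <|> 0       <|> 0       </>
      0 <|> 0 <|> D^^star <|> Omega^^star <|> 0       <|> 0       <|> 0       </>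
      0 <|> A <|> A       <|> 0           <|> 0       <|> 0       <|> Phi     </>
      B <|> 0 <|> A       <|> 0           <|> 0       <|> - Phi   <|> 0)
     = 2 * left_rank (0 <|> A       <|> B </>
                      A <|> A       <|> 0 </>
                      C <|> 0       <|> 0 </>
                      0 <|> D^^star <|> 0))%N <->
  (forall u v x y u' v' x' y',
     u *m A = x *m C -> v *m A = y *m D^^star -> u *m B = v *m B ->
     u' *m A = x' *m C -> v' *m A = y' *m D^^star -> u' *m B = v' *m B ->
     form Phi u v' - form Phi v u' = form Omega x y' - form (Omega^^star) y x').
Proof.
pose L := 0 <|> C <|> 0 </> 0 <|> 0 <|> D^^star </> 0 <|> A <|> A </> B <|> 0 <|> A.
pose L' := (0 <|> C) <|> 0 </> (0 <|> 0) <|> D^^star </> (0 <|> A) <|> A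
           </> (B <|> 0) <|> A.
pose R' := (0 <|> 0 <|> 0 <|> B^^star </> C^^star <|> 0 <|> A^^star <|> 0) </>
           0 <|> D <|> A^^star <|> A^^star.
have rankL' : left_rank L' = left_rank L.
  by rewrite /L' -[RHS]left_rank_assoc !mul_col_mx !row_assocmx.
have rankL : left_rank (0 <|> A <|> B </> A <|> A <|> 0 </> C <|> 0 <|> 0 </>
                        0 <|> D^^star <|> 0) = left_rank L.
  rewrite /L [X in _ = left_rank X]rows4 [RHS](left_rank_rowC divF) -rows4.
  rewrite [RHS]left_rank_colA [RHS](left_rank_colAC divF).
  rewrite [RHS](left_rank_colC divF) -[RHS]left_rank_colA.
  by rewrite -[LHS]left_rank_assoc !mul_col_mx !row_assocmx.
have rankR' : left_rank R' = left_rank L.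
  rewrite /R' -left_rank_colA -(left_rank_conjtrmx divF star_inv) !conjtrmx_col !conjtrmx_row.
  by rewrite !conjtrmxK // !conjtrmx0 // -!rows4.
rewrite rankL mul2n -addnn -{1}rankL' -rankR'.
rewrite -left_rank_assoc !mul_col_mx !row_assocmx.
rewrite -left_rank_assoc !mul_col_mx !row_assocmx.
rewrite [left_rank (_ </> _ </> _ </> _ </> _)]left_rank_colA.
rewrite [left_rank (_ </> _ </> _ </> _ </> _ </> _)]left_rank_colA.
rewrite (rows2 ((0 <|> 0) <|> 0)) (rows2 (((0 <|> 0) <|> 0) </> _)) (rows4 ((0 <|> C) <|> 0)).
rewrite (row_mx0 _ q q p) (row_mx0 _ q (q + p) p) (row_mx0 _ p q p) (row_mx0 _ p (q + p) p).
rewrite (col_mx0 _ q p (q + p + p)) (col_mx0 _ (q + p) p (q + p + p)) -(block_mxEv 0).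
rewrite (left_rank_blockP divF star_inv) /R' !conjtrmx_col !conjtrmx_row.
rewrite !conjtrmxK // !conjtrmx0 // /L'.
have bilin u v u' v' : form Phi u (v' - u') - form Phi (v - u) u'
                       = form Phi u v' - form Phi v u'.
  by rewrite mxformBr // mxformBl opprB addrA subrK.
have kerP (u v : 'rV_m) (x : 'rV_s) (y : 'rV_t) :
    ((v - u) *m B <|> - (x *m C) + u *m A) <|>
      - (y *m D^^star) + (u *m A + (v - u) *m A) = 0
    <-> [/\ u *m A = x *m C, v *m A = y *m D^^star & u *m B = v *m B].
  rewrite !mulmxBl [u *m A + _]addrC subrK; split=> [|[-> -> ->]]; last first.
    by rewrite subrr !addNr !row_mx0.
  rewrite -(row_mx0 F 1 (q + p) p) -(row_mx0 F 1 q p) => /eq_row_mx[/eq_row_mx[]].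
  move=> /eqP; rewrite subr_eq0 => /eqP uB /eqP; rewrite addrC subr_eq0 => /eqP uA.
  by move=> /eqP; rewrite addrC subr_eq0 => /eqP vA.
split=> [H u v x y u' v' x' y' uA vA uB uA' vA' uB' | H x w].
  have := H (- x <|> - y <|> u <|> v - u) (- x' <|> - y' <|> u' <|> v' - u').
  rewrite !mulE => /(_ (proj2 (kerP _ _ _ _) (And3 uA vA uB))).
  move=> /(_ (proj2 (kerP _ _ _ _) (And3 uA' vA' uB'))).
  rewrite !formE bilin => /eqP; rewrite addrA addrC addr_eq0 => /eqP ->.
  by rewrite opprD opprK.
have [x1 [y1 [u [v ->]]]] := row_split4 x; have [w1 [z1 [u' [v' ->]]]] := row_split4 w.
rewrite !mulE => /kerP[uA vA uB] /kerP[uA' vA' uB'].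
rewrite !formE bilin (H _ _ _ _ _ _ _ _ uA vA uB uA' vA' uB').
by rewrite addrA [X in X + _]addrC addrA subrK subrr.
Qed.

End RankConditions.

Theorem theorem3p4 (F : unitRingType) (divF : GRing.field_axiom F)
  (star : F -> F) (star_inv : involutive_antiautomorphism star)
  (charF : 2%N \notin [pchar F])
  (m p q s t : nat)
  (A : 'M[F]_(m, p)) (B : 'M[F]_(m, q)) (C : 'M[F]_(s, p)) (D : 'M[F]_(p, t))
  (Phi : 'M[F]_m) (hPhi : is_hermitian star Phi) (Omega : 'M[F]_(s, t)) :
  (exists (X : 'M[F]_p) (Y : 'M[F]_q),
     [/\ is_hermitian star X, is_hermitian star Y,
         A *m X *m A^^star + B *m Y *m B^^star = Phi
       & C *m X *m D = Omega])
  <->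
  (left_rank (Phi     <|> A </>
              B^^star <|> 0)
     = left_rank A + left_rank B)%N /\
  left_rank (A <|> B <|> Phi) = left_rank (A <|> B) /\
  left_rank (C <|> Omega) = left_rank C /\
  left_rank (D </>
             Omega)
    = left_rank D /\
  (left_rank (Omega <|> 0              <|> C       </>
              0     <|> - Omega^^star  <|> D^^star </>
              D     <|> C^^star        <|> 0)
     = 2 * left_rank (C </>
                      D^^star))%N /\
  (left_rank (0 <|> 0 <|> A^^star <|> D </>
              A <|> B <|> - Phi   <|> 0 </>
              C <|> 0 <|> 0       <|> Omega)
     = left_rank (A <|> B </>
                  C <|> 0)
       + left_rank (A^^star <|> D))%N /\
  (left_rank (0 <|> A^^star <|> D </>
              0 <|> B^^star <|> 0 </>
              A <|> - Phi   <|> 0 </>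
              C <|> 0       <|> Omega)
     = left_rank (A^^star <|> D </>
                  B^^star <|> 0)
       + left_rank (A </>
                    C))%N /\
  (left_rank (0 <|> 0       <|> A^^star <|> D     <|> C^^star </>
              0 <|> 0       <|> B^^star <|> 0     <|> 0       </>
              A <|> A       <|> - Phi   <|> 0     <|> 0       </>
              C <|> 0       <|> 0       <|> Omega <|> 0       </>
              0 <|> D^^star <|> 0       <|> 0     <|> Omega^^star)
     = left_rank (A       <|> B </>
                  C       <|> 0 </>
                  D^^star <|> 0)
       + left_rank (A <|> A </>
                    C <|> 0 </>
                    0 <|> D^^star))%N /\
  (left_rank (0 <|> 0       <|> 0 <|> A^^star <|> D     <|> C^^star </>
              A <|> A       <|> B <|> - Phi   <|> 0     <|> 0       </>
              C <|> 0       <|> 0 <|> 0       <|> Omega <|> 0       </>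
              0 <|> D^^star <|> 0 <|> 0       <|> 0     <|> Omega^^star)
     = left_rank (A </>
                  C </>
                  D^^star)
       + left_rank (A <|> A       <|> B </>
                    C <|> 0       <|> 0 </>
                    0 <|> D^^star <|> 0))%N /\
  (left_rank
     (0 <|> 0 <|> 0       <|> 0           <|> 0       <|> 0       <|> B^^star </>
      0 <|> 0 <|> 0       <|> C^^star     <|> 0       <|> A^^star <|> 0       </>
      0 <|> 0 <|> 0       <|> 0           <|> D       <|> A^^star <|> A^^star </>
      0 <|> C <|> 0       <|> 0           <|> - Omega <|> 0       <|> 0       </>
      0 <|> 0 <|> D^^star <|> Omega^^star <|> 0       <|> 0       <|> 0       </>
      0 <|> A <|> A       <|> 0           <|> 0       <|> 0       <|> Phi     </>
      B <|> 0 <|> A       <|> 0           <|> 0       <|> - Phi   <|> 0)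
     = 2 * left_rank (0 <|> A       <|> B </>
                      A <|> A       <|> 0 </>
                      C <|> 0       <|> 0 </>
                      0 <|> D^^star <|> 0))%N.
Proof.
have form_eq m1 n1 (M N : 'M[F]_(m1, n1)) :
    (forall u w, mxform star M u w = mxform star N u w) -> M = N.
  move=> eqMN; apply/eqP; rewrite -subr_eq0; apply/eqP.
  by apply: (mxform_eq0P star_inv) => u w; rewrite mxformB eqMN subrr.
have AXAE (X : 'M_p) u w :
    mxform star (A *m X *m A^^star) u w = mxform star X (u *m A) (w *m A).
  exact: mxform_mul.
have BYBE (Y : 'M_q) u w :
    mxform star (B *m Y *m B^^star) u w = mxform star Y (u *m B) (w *m B).
  exact: mxform_mul.
have CXDE (X : 'M_p) u w :
    mxform star (C *m X *m D) u w = mxform star X (u *m C) (w *m D^^star).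
  by rewrite -{1}[D](conjtrmxK star_inv) mxform_mul.
suff <- : kernel_conditions star A B C (D^^star) Phi Omega <->
    (exists (X : 'M[F]_p) (Y : 'M[F]_q),
      [/\ is_hermitian star X, is_hermitian star Y,
          A *m X *m A^^star + B *m Y *m B^^star = Phi & C *m X *m D = Omega]).
  rewrite rank_condition1 // (rank_condition2 divF star_inv).
  rewrite (left_rank_rowP divF star_inv) (left_rank_colP divF star_inv).
  rewrite (rank_condition5 divF star_inv) (rank_condition6 divF star_inv).
  rewrite (rank_condition7 divF star_inv) (rank_condition8 divF star_inv).
  by rewrite (rank_condition9 divF star_inv) (rank_condition10 divF star_inv).
split=> [K|[X [Y [hX hY PhiE OmegaE]]]].
  have [X [Y [hX hY PhiE OmegaE]]] := kernel_conditions_solution divF star_inv charF hPhi K.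
  exists X, Y; split=> //; apply: form_eq => u w; last by rewrite CXDE OmegaE.
  by rewrite mxformD AXAE BYBE PhiE.
apply: (solution_kernel_conditions star_inv (X := X) (Y := Y)) => // [u w|x y].
  by rewrite -AXAE -BYBE -mxformD PhiE.
by rewrite -CXDE OmegaE.
Qed.
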